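(* Let $G=\{(n,s)\in\mathbb Z^2 : n+s \text{ even}\}$ and regard $L^+$ and $L^-$ (defined in the context) as functions on $G$. Let $\Gamma$ be the group of transformations of $\mathbb Z^2$ generated by the four reflections with respect to the axes $n=-2$, $n=2$, $s-1=-2$ and $s-1=2$, i.e. by $$(n,s)\mapsto(-4-n,s),\quad (n,s)\mapsto(4-n,s),\quad (n,s)\mapsto(n,-2-s),\quad (n,s)\mapsto(n,6-s).$$ Then the function $(L^+,L^-)$ is invariant under $\Gamma$. A fundamental domain for $\Gamma$ (acting on $G$) is $$F=\{(n,s)\in G : -2\le n\le 2,\ -2\le s-1\le 2\},$$ which consists of 12 points.
   Context: For $p,q\ge0$ with $p+q\ge1$ let $V=\mathbb R^{p,q}$ be the pseudo-Euclidean space with $p$ positive and $q$ negative squares, $n=p+q$, $s=p-q$. The Clifford algebra $C\ell(V)$ uses the convention $v^2=-\langle v,v\rangle$. The spinor module $S$ is an irreducible real $C\ell(V)$-module, viewed as an $\mathfrak{so}(V)$-module. $L^+(n,s)$ (resp. $L^-(n,s)$) is the dimension of the real vector space of $\mathfrak{so}(V)$-equivariant linear maps $\vee^2S\to V$ (resp. $\wedge^2S\to V$), where $\vee^2,\wedge^2$ denote symmetric and exterior squares. Since $L^\pm(n,s)$ depend only on $n$ modulo 8 and $s$ modulo 8, they are considered, by periodic extension, as functions on $G$. *)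

(* Defs.v *)
From HB Require Import structures.
From mathcomp Require Import all_boot all_order all_algebra.
From mathcomp Require Import ring zify.

Set Implicit Arguments.
Unset Strict Implicit.
Unset Printing Implicit Defensive.

Import Order.TTheory GRing.Theory Num.Theory.

Local Open Scope ring_scope.

Section SymDiff.
Variable T : finType.
Implicit Types A B C : {set T}.

Definition symdiff A B : {set T} := [set i | (i \in A) (+) (i \in B)].

Lemma symdiffA A B C : symdiff A (symdiff B C) = symdiff (symdiff A B) C.
Proof. by apply/setP=> i; rewrite !inE addbA. Qed.

Lemma symdiffC A B : symdiff A B = symdiff B A.
Proof. by apply/setP=> i; rewrite !inE addbC. Qed.

Lemma symdiff0 A : symdiff set0 A = A.
Proof. by apply/setP=> i; rewrite !inE. Qed.

Lemma symdiffv A : symdiff A A = set0.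
Proof. by apply/setP=> i; rewrite !inE addbb. Qed.

Lemma symdiffK A B : symdiff A (symdiff A B) = B.
Proof. by rewrite symdiffA symdiffv symdiff0. Qed.

End SymDiff.

Section Clifford.
Variables (R : realFieldType) (p q : nat).
Local Notation n := (p + q)%N.
Implicit Types A B C : {set 'I_n}.

Definition psgn (i : 'I_n) : R := if (i < p)%N then 1 else -1.

Definition pform (v w : 'cV[R]_n) : R := \sum_i psgn i * v i 0 * w i 0.

(* The Clifford algebra with v ^ 2 = - <v, v>, realised on the basis
   e_A = e_(i1) ... e_(ik), for A = {i1 < ... < ik}; the basis products are
   e_A * e_B = clsign A B *: e_(symdiff A B).
   The universal property is clifford_universal below. *)
Definition clifford := {ffun {set 'I_n} -> R^o}.

HB.instance Definition _ := Vector.on clifford.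

Definition gensign (i j : 'I_n) : R :=
  if i == j then - psgn i else (-1) ^+ (j < i)%N.

Definition clsign A B : R := \prod_(i in A) \prod_(j in B) gensign i j.

Definition clunit : clifford := [ffun A => (A == set0)%:R].

Definition clmul (a b : clifford) : clifford :=
  [ffun C => \sum_A clsign A (symdiff A C) * (a A * b (symdiff A C))].

Lemma psgn_sq i : psgn i * psgn i = 1.
Proof. by rewrite /psgn; case: ifP; rewrite ?mulr1 ?mulrNN ?mulr1. Qed.

Lemma gensign_sq i j : gensign i j * gensign i j = 1.
Proof.
rewrite /gensign; case: eqP => _; first by rewrite mulrNN psgn_sq.
by rewrite -expr2 sqrr_sign.
Qed.

Let prod_symdiff (f : 'I_n -> R) A B : (forall i, f i * f i = 1) ->
  \prod_(i in symdiff A B) f i = (\prod_(i in A) f i) * \prod_(i in B) f i.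
Proof.
move=> fE; rewrite (big_mkcond (mem (symdiff A B))) (big_mkcond (mem A)).
rewrite (big_mkcond (mem B)) -big_split /=; apply: eq_bigr => i _.
by rewrite inE; case: (i \in A); case: (i \in B) => /=; rewrite ?mulr1 ?mul1r ?fE.
Qed.

Lemma clsignDl A B C : clsign (symdiff A B) C = clsign A C * clsign B C.
Proof.
apply: prod_symdiff => i; rewrite -big_split big1 // => j _.
exact: gensign_sq.
Qed.

Lemma clsignDr A B C : clsign A (symdiff B C) = clsign A B * clsign A C.
Proof.
rewrite /clsign -big_split; apply: eq_bigr => i _.
by apply: prod_symdiff => j; apply: gensign_sq.
Qed.

Lemma clsign0l A : clsign set0 A = 1.
Proof. by rewrite /clsign big_set0. Qed.

Lemma clsign0r A : clsign A set0 = 1.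
Proof. by rewrite /clsign big1 // => i _; rewrite big_set0. Qed.

Lemma clmulA : associative clmul.
Proof.
move=> a b c; apply/ffunP=> C; rewrite !ffunE.
under eq_bigr => A _.
  rewrite ffunE mulr_sumr mulr_sumr.
  over.
under [RHS]eq_bigr => D _.
  rewrite ffunE mulr_suml mulr_sumr.
  over.
rewrite [RHS]exchange_big; apply: eq_bigr => A _ /=.
rewrite [RHS](reindex_inj (can_inj (symdiffK A))); apply: eq_bigr => B _ /=.
rewrite symdiffK clsignDl.
set X := symdiff (symdiff A B) C.
have -> : symdiff B (symdiff A C) = X by rewrite /X symdiffA (symdiffC B).
have -> : symdiff A C = symdiff B X by rewrite /X (symdiffC A B) -symdiffA symdiffK.
rewrite clsignDr; ring.
Qed.

Lemma clmul1l : left_id clunit clmul.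
Proof.
move=> a; apply/ffunP=> C; rewrite ffunE (bigD1 set0) //= big1 => [|A /negPf nA].
  by rewrite ffunE eqxx symdiff0 clsign0l !mul1r addr0.
by rewrite ffunE nA mul0r mulr0.
Qed.

Lemma clmul1r : right_id clunit clmul.
Proof.
move=> a; apply/ffunP=> C; rewrite ffunE (bigD1 C) //= big1 => [|A nA].
  by rewrite ffunE symdiffv eqxx clsign0r mulr1 mul1r addr0.
rewrite ffunE; case: eqP => [E|_]; last by rewrite !mulr0.
by case/eqP: nA; rewrite -(symdiffK A C) E symdiffC symdiff0.
Qed.

Lemma clmulDl : left_distributive clmul +%R.
Proof.
move=> a b c; apply/ffunP=> C; rewrite !ffunE -big_split.
by apply: eq_bigr => A _; rewrite ffunE mulrDl mulrDr.
Qed.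

Lemma clmulDr : right_distributive clmul +%R.
Proof.
move=> a b c; apply/ffunP=> C; rewrite !ffunE -big_split.
by apply: eq_bigr => A _; rewrite ffunE !mulrDr.
Qed.

Lemma clunit_neq0 : clunit != 0.
Proof.
by apply/eqP=> /ffunP/(_ set0)/eqP; rewrite !ffunE eqxx oner_eq0.
Qed.

HB.instance Definition _ := GRing.Zmodule_isNzRing.Build clifford
  clmulA clmul1l clmul1r clmulDl clmulDr clunit_neq0.

Lemma clscaleAl (k : R) (a b : clifford) : k *: (a * b) = k *: a * b.
Proof.
apply/ffunP=> C; rewrite !ffunE scaler_sumr; apply: eq_bigr => A _.
by rewrite ffunE /GRing.scale /=; ring.
Qed.

HB.instance Definition _ := GRing.Lmodule_isLalgebra.Build R clifford clscaleAl.

Lemma clscaleAr (k : R) (a b : clifford) : k *: (a * b) = a * (k *: b).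
Proof.
apply/ffunP=> C; rewrite !ffunE scaler_sumr; apply: eq_bigr => A _.
by rewrite ffunE /GRing.scale /=; ring.
Qed.

HB.instance Definition _ := GRing.Lalgebra_isAlgebra.Build R clifford clscaleAr.

Definition clbasis A : clifford := [ffun B => (B == A)%:R].

Definition cliota (v : 'cV[R]_n) : clifford := \sum_i v i 0 *: clbasis [set i].

Fact cliota_is_linear : linear cliota.
Proof.
move=> k u v; rewrite /cliota scaler_sumr -big_split; apply: eq_bigr => i _.
by rewrite !mxE scalerDl scalerA.
Qed.

HB.instance Definition _ := GRing.isLinear.Build R _ _ _ cliota cliota_is_linear.

Lemma clbasis_sum (a : clifford) : a = \sum_A (a A : R) *: clbasis A.
Proof.
apply/ffunP=> B; rewrite sum_ffunE (bigD1 B) //= big1 => [|A nA].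
  by rewrite !ffunE eqxx addr0 /GRing.scale /= mulr1.
by rewrite !ffunE eq_sym (negPf nA) scaler0.
Qed.

Lemma clbasisM A B :
  clbasis A * clbasis B = clsign A B *: clbasis (symdiff A B).
Proof.
apply/ffunP=> C; rewrite !ffunE (bigD1 A) //= big1 => [|D nD].
  rewrite !ffunE eqxx mul1r addr0 /GRing.scale /=.
  have [->|nC] := eqVneq C (symdiff A B); first by rewrite symdiffK eqxx.
  case: eqP => [E|_]; last by rewrite !mulr0.
  by case/eqP: nC; rewrite -E symdiffK.
by rewrite !ffunE (negPf nD) mul0r mulr0.
Qed.

Lemma clbasis0 : clbasis set0 = 1.
Proof. by []. Qed.

Lemma cliota_delta i : cliota (delta_mx i 0) = clbasis [set i].
Proof.
rewrite /cliota (bigD1 i) //= big1 => [|j nj].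
  by rewrite mxE !eqxx scale1r addr0.
by rewrite mxE (negPf nj) scale0r.
Qed.

Lemma cliotaM_sym (v w : 'cV[R]_n) :
  cliota v * cliota w + cliota w * cliota v = - (2%:R * pform v w)%:A.
Proof.
pose e i := clbasis [set i].
have eC i j : e i * e j + e j * e i = if i == j then - (2%:R * psgn i)%:A else 0.
  rewrite /e !clbasisM /clsign !big_set1 /gensign (eq_sym j i).
  case: eqP => [<-|/eqP nij].
    by rewrite symdiffv clbasis0 -scalerDl -scaleNr -opprD mulr_natl mulr2n.
  rewrite (symdiffC [set j]) -scalerDl.
  have /orP[lt|lt] : (i < j)%N || (j < i)%N by rewrite -neq_ltn.
  - by rewrite lt (ltnNge j i) (ltnW lt) /= expr1 expr0 addrN scale0r.
  - by rewrite lt (ltnNge i j) (ltnW lt) /= expr1 expr0 addNr scale0r.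
have -> : cliota w * cliota v = \sum_i \sum_j (v i 0 * w j 0) *: (e j * e i).
  rewrite /cliota exchange_big mulr_suml; apply: eq_bigr => j _.
  rewrite mulr_sumr; apply: eq_bigr => i _.
  by rewrite -scalerAl -scalerAr scalerA mulrC.
rewrite /cliota mulr_suml -big_split -scaleNr -mulNr mulr_sumr scaler_suml.
apply: eq_bigr => i _.
rewrite mulr_sumr -big_split (bigD1 i) //= big1 => [|j nj].
  rewrite addr0 -scalerAl -scalerAr scalerA -scalerDr eC eqxx.
  by rewrite -scaleNr scalerA; congr (_ *: _); ring.
rewrite -scalerAl -scalerAr scalerA -scalerDr eC eq_sym (negPf nj).
by rewrite scaler0.
Qed.

Lemma cliota_sq (v : 'cV[R]_n) : cliota v * cliota v = - (pform v v)%:A.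
Proof.
apply: (scalerI (_ : 2%:R != 0 :> R)); first by rewrite pnatr_eq0.
by rewrite scaler_nat mulr2n cliotaM_sym scalerN scalerA.
Qed.

Definition so (A : 'M[R]_n) : Prop :=
  forall v w : 'cV[R]_n, pform (A *m v) w + pform v (A *m w) = 0.

(* The isomorphism of so(V) with the Lie algebra spin(V) = span {[v, w]}
   inside the Clifford algebra, i.e. the inverse of a |-> [a, -]
   (see spinlift_ad). *)
Definition spinlift (A : 'M[R]_n) : clifford :=
  8%:R^-1 *: \sum_i psgn i *: (cliota (delta_mx i 0) * cliota (A *m delta_mx i 0)
                               - cliota (A *m delta_mx i 0) * cliota (delta_mx i 0)).

Lemma pformC (v w : 'cV[R]_n) : pform v w = pform w v.
Proof. by apply: eq_bigr => i _; rewrite mulrAC. Qed.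

Lemma pform_delta i (v : 'cV[R]_n) : pform (delta_mx i 0) v = psgn i * v i 0.
Proof.
rewrite /pform (bigD1 i) //= big1 => [|j nj]; first by rewrite mxE !eqxx addr0 mulr1.
by rewrite mxE (negPf nj) mulr0 mul0r.
Qed.

Lemma cV_sum (v : 'cV[R]_n) : v = \sum_i v i 0 *: delta_mx i 0.
Proof.
rewrite [LHS]matrix_sum_delta; apply: eq_bigr => i _.
by rewrite big_ord1.
Qed.

Lemma spinliftE (A : 'M[R]_n) : so A ->
  spinlift A =
  4%:R^-1 *: \sum_i psgn i *: (cliota (delta_mx i 0) * cliota (A *m delta_mx i 0)).
Proof.
move=> soA; rewrite /spinlift !scaler_sumr; apply: eq_bigr => i _.
set x := delta_mx i 0.
have x0 : pform x (A *m x) = 0.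
  have /eqP := soA x x; rewrite pformC -mulr2n mulrn_eq0 /= => /eqP.
  by [].
have -> : cliota (A *m x) * cliota x = - (cliota x * cliota (A *m x)).
  by apply/eqP; rewrite -addr_eq0 addrC cliotaM_sym x0 mulr0 scale0r oppr0.
rewrite opprK -mulr2n -scaler_nat !scalerA; congr (_ *: _).
by field.
Qed.

Lemma spinlift_ad (A : 'M[R]_n) (v : 'cV[R]_n) : so A ->
  spinlift A * cliota v - cliota v * spinlift A = cliota (A *m v).
Proof.
move=> soA.
have adE (x y z : clifford) :
    x * y * z - z * (x * y) = x * (y * z + z * y) - (x * z + z * x) * y.
  by rewrite mulrDr mulrDl !mulrA opprD addrA addrK.
rewrite spinliftE // -scalerAl -scalerAr -scalerBr mulr_suml mulr_sumr -sumrB.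
pose e i : 'cV[R]_n := delta_mx i 0.
have -> : \sum_(i < n) ((psgn i *: (cliota (e i) * cliota (A *m e i))) * cliota v
    - cliota v * (psgn i *: (cliota (e i) * cliota (A *m e i))))
  = \sum_(i < n) cliota (2%:R *: ((A *m v) i 0 *: e i + v i 0 *: (A *m e i))).
  apply: eq_bigr => i _; rewrite -scalerAl -scalerAr -scalerBr adE !cliotaM_sym.
  have -> : pform (A *m e i) v = - (psgn i * (A *m v) i 0).
    by rewrite -pform_delta -/(e i); apply/eqP; rewrite -addr_eq0 soA.
  rewrite pform_delta.
  have -> (k l : R) (x y : 'cV[R]_n) : cliota (2%:R *: (k *: x + l *: y)) =
      (2%:R * k) *: cliota x + (2%:R * l) *: cliota y.
    by rewrite scalerDr !scalerA linearD !linearZ.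
  rewrite mulNr opprK -scaleNr -mulrN opprK -scalerAr mulr1 -scalerAl mul1r.
  by rewrite scalerDr !scalerA !(mulrCA (psgn i)) !(mulrA (psgn i)) psgn_sq !mul1r.
rewrite -linear_sum -scaler_sumr big_split /= -cV_sum.
have -> : \sum_(i < n) v i 0 *: (A *m e i) = A *m v.
  by rewrite [in RHS](cV_sum v) mulmx_sumr; apply: eq_bigr => i _; rewrite scalemxAr.
rewrite -mulr2n -scaler_nat scalerA linearZ scalerA /=.
by rewrite -natrM mulVf ?scale1r // pnatr_eq0.
Qed.

Section Universal.
Variables (B : algType R) (f : {linear 'cV[R]_n -> B}).
Hypothesis f_sq : forall v, f v * f v = - (pform v v)%:A.

Let F i := f (delta_mx i 0).
Let P (A : {set 'I_n}) : B := \prod_(i in A) F i.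

Let FM i : F i * F i = (- psgn i)%:A.
Proof. by rewrite f_sq pform_delta mxE !eqxx mulr1 scaleNr. Qed.

Let FC i j : i != j -> F i * F j = - (F j * F i).
Proof.
move=> nij; apply/eqP; rewrite -addr_eq0.
have := f_sq (delta_mx i 0 + delta_mx j 0).
rewrite linearD /= mulrDl !mulrDr -!/(F _) !FM.
have -> : pform (delta_mx i 0 + delta_mx j 0) (delta_mx i 0 + delta_mx j 0)
   = psgn i + psgn j.
  transitivity (pform (delta_mx i 0) (delta_mx i 0 + delta_mx j 0)
    + pform (delta_mx j 0) (delta_mx i 0 + delta_mx j 0)).
    rewrite -big_split; apply: eq_bigr => k _ /=.
    by rewrite !mxE -mulrDl -mulrDr.
  by rewrite !pform_delta !mxE !eqxx (eq_sym j i) (negPf nij) add0r addr0 !mulr1.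
rewrite -scaleNr opprD scalerDl [F j * F i + _]addrC addrACA.
by move/(canRL (addKr _)); rewrite addNr => ->.
Qed.

Let FP i A : F i * P A = clsign [set i] A *: P (symdiff [set i] A).
Proof.
rewrite /clsign big_set1 /P.
have : i \in index_enum 'I_n by rewrite mem_index_enum.
have : sorted ltn (map val (index_enum 'I_n)).
  by rewrite [index_enum _]unlock -enumT val_enum_ord iota_ltn_sorted.
elim: (index_enum _) => [//|k s IHs] /= pks.
have ss := path_sorted pks.
have /allP ks : all (ltn k) (map val s) by apply: order_path_min pks; apply: ltn_trans.
rewrite inE !big_cons !inE => /predU1P si.
have [ki|nik] := eqVneq i k; last first.
  case: si => [/eqP|si]; first by rewrite (negPf nik).
  have ki : (k < i)%N by apply: ks; apply: map_f.
  case: ifP => kA; last by apply: IHs.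
  rewrite mulrA FC // mulNr -mulrA IHs // /gensign (negPf nik) ki expr1.
  by rewrite -scalerAr -scaleNr mulN1r.
move: ki ks => <- ks {si pks}.
have Dj j : j \in s -> (j \in symdiff [set i] A) = (j \in A).
  move=> sj; rewrite !inE; case: eqP => // ji.
  by have := ks _ (map_f val sj); rewrite ji /= ltnn.
have -> : \prod_(j <- s | j \in symdiff [set i] A) F j = \prod_(j <- s | j \in A) F j.
  rewrite [LHS]big_seq_cond [RHS]big_seq_cond; apply: eq_bigl => j.
  by case sj: (j \in s) => //=; apply: Dj.
have -> : \prod_(j <- s | j \in A) gensign i j = 1.
  rewrite big_seq_cond big1 // => j /andP[sj _].
  have ij := ks _ (map_f val sj); rewrite /gensign ifN.
    by rewrite ltnNge ltnW.
  by apply/eqP=> ij'; rewrite /= ij' ltnn in ij.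
case: (i \in A) => /=; last by rewrite scale1r.
by rewrite mulrA FM -scalerAl mul1r mulr1 /gensign eqxx.
Qed.

Let phi (a : clifford) : B := \sum_A (a A : R) *: P A.

Fact clifford_lift_is_linear : linear phi.
Proof.
move=> k a b; rewrite /phi scaler_sumr -big_split; apply: eq_bigr => A _.
by rewrite !ffunE scalerDl scalerA.
Qed.

HB.instance Definition _ := GRing.isLinear.Build R _ _ _ phi clifford_lift_is_linear.

Let phi_basis A : phi (clbasis A) = P A.
Proof.
rewrite /phi (bigD1 A) //= big1 => [|C nC]; first by rewrite ffunE eqxx addr0 scale1r.
by rewrite ffunE (negPf nC) scale0r.
Qed.

Let phi_gen i b : phi (clbasis [set i] * b) = F i * phi b.
Proof.
rewrite (clbasis_sum b) mulr_sumr !linear_sum mulr_sumr; apply: eq_bigr => A _.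
by rewrite -scalerAr !linearZ /= clbasisM linearZ /= !phi_basis -FP -scalerAr.
Qed.

Lemma clbasis_ind (K : {set 'I_n} -> Prop) : K set0 ->
  (forall i A c, K A -> clbasis (i |: A) = c *: (clbasis [set i] * clbasis A) ->
   K (i |: A)) -> forall A, K A.
Proof.
move=> K0 KS A; elim: {A}#|A| {-2}A (erefl #|A|) => [|k IH] A.
  by move/cards0_eq->.
have [->|[i Ai]] := set_0Vmem A; first by rewrite cards0.
rewrite -(setD1K Ai) cardsU1 setD11 => -[cA].
apply: (KS _ _ (clsign [set i] (A :\ i))); first exact: IH.
rewrite clbasisM scalerA -[_ * _]clsignDl symdiffv clsign0l scale1r.
congr clbasis; apply/setP=> j; rewrite !inE.
by case: eqVneq.
Qed.

Let phiM a b : phi (a * b) = phi a * phi b.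
Proof.
rewrite (clbasis_sum a) mulr_suml !linear_sum mulr_suml; apply: eq_bigr => A _.
rewrite -scalerAl !linearZ /= -scalerAl; congr (_ *: _).
elim/clbasis_ind: A b => [|i A c IH ->] b; first by rewrite mul1r phi_basis /P big_set0 mul1r.
by rewrite -scalerAl !linearZ /= -mulrA !phi_gen IH mulrA -scalerAl.
Qed.

Fact clifford_lift_is_monoid_morphism : monoid_morphism phi.
Proof. by split=> [|a b]; rewrite ?phiM // -clbasis0 phi_basis /P big_set0. Qed.

HB.instance Definition _ :=
  GRing.isMonoidMorphism.Build clifford B phi clifford_lift_is_monoid_morphism.

Lemma clifford_universal :
  exists h : {lrmorphism clifford -> B}, (forall v, h (cliota v) = f v) /\
    forall h' : {lrmorphism clifford -> B},
      (forall v, h' (cliota v) = f v) -> h' =1 h.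
Proof.
exists phi; split=> [v|h' h'E a].
  rewrite [in RHS](cV_sum v) /cliota !linear_sum; apply: eq_bigr => i _.
  by rewrite !linearZ /= phi_basis /P big_set1.
rewrite (clbasis_sum a) !linear_sum; apply: eq_bigr => A _.
rewrite !linearZ /=; congr (_ *: _).
elim/clbasis_ind: A => [|i A c IH ->].
  by rewrite clbasis0 rmorph1 -clbasis0 phi_basis /P big_set0.
by rewrite !linearZ /= !rmorphM /= IH (phi_basis [set i]) -cliota_delta h'E /P big_set1.
Qed.

End Universal.

End Clifford.

From mathcomp Require Import boolp classical_sets functions cardinality reals.

Local Open Scope classical_set_scope.

Section Squares.
Variables (R : realFieldType) (m : nat).

(* S (x) S is 'M[R]_m for S = 'cV[R]_m, with s (x) t = s *m t^T; as the
   characteristic is 0, the symmetric and exterior squares of S are the spaces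
   of symmetric and of skew-symmetric tensors. *)
Definition sym2 : {vspace 'M[R]_m} := lker (linfun trmx - \1)%VF.
Definition ext2 : {vspace 'M[R]_m} := lker (linfun trmx + \1)%VF.

Lemma mem_sym2 (M : 'M[R]_m) : (M \in sym2) = (M^T == M).
Proof. by rewrite memv_ker add_lfunE opp_lfunE lfunE id_lfunE subr_eq0. Qed.

Lemma mem_ext2 (M : 'M[R]_m) : (M \in ext2) = (M^T == - M).
Proof. by rewrite memv_ker add_lfunE lfunE id_lfunE addr_eq0. Qed.

(* X (s (x) t) = X s (x) t + s (x) X t *)
Definition tens_act (X M : 'M[R]_m) : 'M[R]_m := X *m M + M *m X^T.

Lemma tens_actE (X : 'M[R]_m) (s t : 'cV[R]_m) :
  tens_act X (s *m t^T) = (X *m s) *m t^T + s *m (X *m t)^T.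
Proof. by rewrite /tens_act trmx_mul !mulmxA. Qed.

Lemma tens_act_sym2 (X M : 'M[R]_m) : M \in sym2 -> tens_act X M \in sym2.
Proof.
by rewrite !mem_sym2 => /eqP MT; rewrite linearD /= !trmx_mul trmxK MT addrC.
Qed.

Lemma tens_act_ext2 (X M : 'M[R]_m) : M \in ext2 -> tens_act X M \in ext2.
Proof.
rewrite !mem_ext2 => /eqP MT.
by rewrite linearD /= !trmx_mul trmxK MT mulmxN mulNmx opprD addrC.
Qed.

End Squares.

Section SpinorSquares.
Variables (R : realFieldType) (p q : nat).
Local Notation n := (p + q)%N.

Definition clmodule (m : nat) := {lrmorphism clifford R p q -> 'M[R]_m}.

Definition irreducible (m : nat) (rho : clmodule m) : Prop :=
  (0 < m)%N /\
  forall U : {vspace 'cV[R]_m},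
    (forall a s, s \in U -> rho a *m s \in U) -> U = 0%VS \/ U = fullv.

(* The stable subspace W of S (x) S is meant to be sym2 or ext2, so that
   vsproj does not alter the tensor it is applied to. *)
Definition equivariant (m : nat) (rho : clmodule m) (W : {vspace 'M[R]_m})
    (j : 'Hom(subvs_of W, 'cV[R]_n)) : Prop :=
  forall (A : 'M[R]_n) (w : subvs_of W), so A ->
    j (vsproj W (tens_act (rho (spinlift A)) (vsval w))) = A *m j w.

(* [set d] is the set of dimensions obtained from all choices of the spinor
   module; it is a singleton. *)
Definition equivariant_dim (sq : forall m, {vspace 'M[R]_m}) : nat :=
  xget 0%N [set d | exists m (rho : clmodule m)
      (U : {vspace 'Hom(subvs_of (sq m), 'cV[R]_n)}),
    [/\ irreducible rho,
        forall j, j \in U <-> equivariant rho j &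
        d = \dim U]].

End SpinorSquares.

Definition Z2 : Type := (int * int)%type.

Definition G : set Z2 := [set x | (2 %| x.1 + x.2)%Z].

(* The periodic extension of a function of (n, s) = (p + q, p - q). It takes the
   value at any signature (p, q) representing (n, s) modulo 8. *)
Definition periodic_ext (l : nat -> nat -> nat) (x : Z2) : nat :=
  xget 0%N [set d | exists p q : nat,
    [/\ (1 <= p + q)%N,
        ((p + q)%N%:Z = x.1 %[mod 8])%Z,
        (p%:Z - q%:Z = x.2 %[mod 8])%Z &
        d = l p q]].

Definition Lplus (R : realType) : Z2 -> nat :=
  periodic_ext (fun p q => equivariant_dim p q (@sym2 R)).

Definition Lminus (R : realType) : Z2 -> nat :=
  periodic_ext (fun p q => equivariant_dim p q (@ext2 R)).

Definition reflections : set (Z2 -> Z2) :=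
  [set (fun x => (- 4 - x.1, x.2)); (fun x => (4 - x.1, x.2));
       (fun x => (x.1, - 2 - x.2)); (fun x => (x.1, 6 - x.2))].

Inductive generated (T : Type) (X : set (T -> T)) : set (T -> T) :=
| gen_in g : X g -> generated X g
| gen_id : generated X id
| gen_comp g h : generated X g -> generated X h -> generated X (g \o h)
| gen_inv g h : generated X g -> cancel g h -> cancel h g -> generated X h.

Definition Gamma : set (Z2 -> Z2) := generated reflections.

Definition fundamental_domain (T : Type) (H : set (T -> T)) (X D : set T) : Prop :=
  [/\ forall g x, H g -> X x -> X (g x),
      D `<=` X &
      forall x, X x -> exists! y, D y /\ exists2 g, H g & g x = y].

Definition F : set Z2 :=
  [set x | [/\ G x, - 2 <= x.1 <= 2 & - 2 <= x.2 - 1 <= 2]].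

(* Main.v *)
From HB Require Import structures.
Require Import Defs.
From mathcomp Require Import all_boot all_order all_algebra.
From mathcomp Require Import ring lra zify.
From mathcomp Require Import boolp.
From mathcomp.real_closed Require Import complex.

(** Write E_i for the action of the basis vector e_i on the spinor module S,
    m for the dimension of S, n = p + q, s = p - q, and let eps be 1 for the
    symmetric and -1 for the exterior square. The proof computes L^+ and L^- by
    counting traces, without the classification of Clifford algebras.

    An equivariant map j from the square of S to V is the same thing as a
    bilinear form B on S with E_i^T B = eps B^T E_i for all i, through
    <v, j(s, t)> = B(v s, t) ([form_map_equivariant], [form_map_surj]). Such
    forms are the common fixed vectors of an action of the group of subsets of
    {1, ..., n} (under symmetric difference) on all bilinear forms, so their
    dimension is an average of traces. Almost all of these traces vanish, and
    [dim_twisted] gives 2^n L = m^2 + eps m Im (1 + i)^n.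

    The dimension m is found in the same way. If S is irreducible, the symmetric
    bilinear forms invariant under all products of the e_i form a line: there is
    a positive definite one H, and for any other one M some M - a H is singular,
    hence zero ([invform_unique]). Counting traces again turns this into the
    quadratic equation [spinor_dim] for m, whose coefficients are sums of signs
    equal to the real part of (1 - i) (1 - i)^p (1 + i)^q.

    With mu = m / sqrt(2)^n and the eighth root of unity zeta = (1 + i) / sqrt 2
    this reads, as in [equivariant_dimP],
      a mu^2 + sqrt 2 Re(zeta^(s + 1)) mu = 2,   L = mu^2 + eps mu Im(zeta^n),
    where a is 2 if s = 3 modulo 4 and 1 otherwise. The first equation
    determines mu > 0 and depends only on s modulo 8; it is unchanged by
    s |-> -2 - s, which conjugates zeta^(s + 1). The number Im(zeta^n) depends
    only on n modulo 8 and is unchanged by n |-> 4 - n, since zeta^4 = -1. This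
    is the invariance under Gamma; the statements on the fundamental domain are
    elementary. *)

Set Implicit Arguments.
Unset Strict Implicit.
Unset Printing Implicit Defensive.

Import Order.TTheory GRing.Theory Num.Theory.

Local Open Scope ring_scope.

(** * Traces of operators on matrices and dimensions of fixed spaces *)

Section TraceFormula.
Variables (F : fieldType).

Lemma mxtrace_idempotent N (P : 'M[F]_N) : P *m P = P -> \tr P = (\rank P)%:R.
Proof.
move=> PP; rewrite -[P in LHS]mulmx_base mxtrace_mulC.
suff -> : row_base P *m col_base P = 1%:M by rewrite mxtrace1.
apply: (row_free_inj (row_base_free P)); rewrite mul1mx -mulmxA mulmx_base.
apply: (row_full_inj (col_base_full P)).
by rewrite mulmxA mulmx_base PP.
Qed.

Variable m : nat.

(** The trace of an operator on matrices, in the basis of elementary matrices. *)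
Definition optrace (f : 'M[F]_m -> 'M[F]_m) : F :=
  \sum_i \sum_j f (delta_mx i j) i j.

Lemma optraceZ k f : optrace (fun M => k *: f M) = k * optrace f.
Proof.
rewrite /optrace mulr_sumr; apply: eq_bigr => i _.
by rewrite mulr_sumr; apply: eq_bigr => j _; rewrite mxE.
Qed.

Lemma optrace_sum (I : finType) (f : I -> 'M[F]_m -> 'M[F]_m) :
  optrace (fun M => \sum_k f k M) = \sum_k optrace (f k).
Proof.
rewrite /optrace [RHS]exchange_big; apply: eq_bigr => i _.
by rewrite [RHS]exchange_big; apply: eq_bigr => j _; rewrite summxE.
Qed.

Lemma mul_delta_mxE (P Q : 'M[F]_m) i j k l :
  (P *m delta_mx i j *m Q) k l = P k i * Q j l.
Proof.
rewrite !mxE (bigD1 j) //= big1 => [|a na].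
  rewrite addr0 !mxE (bigD1 i) //= big1 => [|a na].
    by rewrite !mxE !eqxx mulr1 addr0.
  by rewrite !mxE (negPf na) mulr0.
rewrite !mxE big1 ?mul0r // => b _.
by rewrite !mxE (negPf na) andbF mulr0.
Qed.

Lemma optrace_mul (P Q : 'M[F]_m) :
  optrace (fun M => P *m M *m Q) = \tr P * \tr Q.
Proof.
rewrite /optrace /mxtrace mulr_suml; apply: eq_bigr => i _.
by rewrite mulr_sumr; apply: eq_bigr => j _; rewrite mul_delta_mxE.
Qed.

Lemma optrace_mul_tr (P Q : 'M[F]_m) :
  optrace (fun M => P *m M^T *m Q) = \tr (P^T *m Q).
Proof.
rewrite /optrace /mxtrace exchange_big; apply: eq_bigr => i _.
rewrite mxE; apply: eq_bigr => j _.
by rewrite trmx_delta mul_delta_mxE !mxE.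
Qed.

Lemma dim_fixed_idempotent (f : 'M[F]_m -> 'M[F]_m) (K : {vspace 'M[F]_m}) :
  linear f -> (forall M, f (f M) = f M) -> (forall M, (M \in K) = (f M == M)) ->
  (\dim K)%:R = optrace f.
Proof.
move=> lf ff Kf; pose L := lin_mx f.
pose lin_f : {linear 'M[F]_m -> 'M[F]_m} :=
  HB.pack f (GRing.isLinear.Build _ _ _ _ f lf).
have LE u : u *m L = mxvec (f (vec_mx u)).
  by rewrite -[u in LHS]vec_mxK; apply: (mul_vec_lin lin_f).
have LL : L *m L = L.
  apply/row_matrixP=> k; rewrite row_mul !rowE !LE.
  by rewrite mxvecK ff.
have -> : optrace f = \tr L.
  rewrite /optrace pair_big /mxtrace.
  rewrite (reindex _ (curry_mxvec_bij m m)) /=.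
  apply: eq_bigr => -[i j] _ /=.
  by rewrite -[LHS]mxvecE -[delta_mx i j]mxvecK mxvec_delta -LE -rowE mxE.
rewrite mxtrace_idempotent //.
pose g := linfun (vec_mx \o (mulmxr (row_base L)) : 'rV[F]_(\rank L) -> 'M[F]_m).
have gE v : g v = vec_mx (v *m row_base L) by rewrite lfunE.
have g0 : lker g == 0%VS.
  apply/lker0P => u v; rewrite !gE => /(can_inj vec_mxK).
  exact: (row_free_inj (row_base_free L)).
have -> : K = limg g.
  apply/vspaceP => M; rewrite Kf; apply/eqP/idP=> [fM|/memv_imgP[v _ ->]].
    have : (mxvec M <= row_base L)%MS.
      by rewrite eq_row_base -[M]fM -[M in f M]mxvecK -LE submxMl.
    by case/submxP=> v Mv; rewrite -[M]mxvecK Mv -gE memv_img ?memvf.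
  rewrite gE; have [w ->] : exists w, v *m row_base L = w *m L.
    by apply/submxP; rewrite -(eq_row_base L) submxMl.
  by rewrite LE mxvecK ff.
rewrite limg_dim_eq; last by rewrite (eqP g0) capv0.
by rewrite dimvf; congr _%:R; apply: mul1n.
Qed.

(** The mean of a finite family of linear operators that composes like a
    group is a projection onto the common fixed space, so the dimension of that
    space is the mean of the traces. *)
Lemma dim_fixed_family (I : finType) (op : I -> I -> I)
    (f : I -> 'M[F]_m -> 'M[F]_m) (K : {vspace 'M[F]_m}) :
  #|I|%:R != 0 :> F -> (forall i, injective (op i)) ->
  (forall i, linear (f i)) -> (forall i j M, f i (f j M) = f (op i j) M) ->
  (forall M, M \in K <-> forall i, f i M = M) ->
  (\dim K)%:R * #|I|%:R = \sum_i optrace (f i).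
Proof.
move=> I0 op_inj lf fM Kf.
pose g M := #|I|%:R^-1 *: \sum_i f i M.
have fg i M : f i (g M) = g M.
  pose lin_f : {linear 'M[F]_m -> 'M[F]_m} :=
    HB.pack (f i) (GRing.isLinear.Build _ _ _ _ (f i) (lf i)).
  rewrite /g -[f i]/(lin_f : _ -> _) linearZ linear_sum /=; congr (_ *: _).
  by rewrite [RHS](reindex_inj (op_inj i)); apply: eq_bigr => j _; rewrite /= fM.
have gK M : (forall i, f i M = M) -> g M = M.
  move=> fix_M; rewrite /g (eq_bigr (fun=> M)) // sumr_const.
  by rewrite -scaler_nat scalerA mulVf ?scale1r.
have lin_g : linear g.
  move=> k M N; rewrite /g scalerA mulrC -scalerA -scalerDr; congr (_ *: _).
  by rewrite scaler_sumr -big_split; apply: eq_bigr => i _; apply: lf.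
rewrite (dim_fixed_idempotent lin_g).
- by rewrite /g optraceZ optrace_sum mulrAC mulVf // mul1r.
- by move=> M; apply: gK => i; apply: fg.
- move=> M; apply/idP/eqP => [/Kf /gK//|gM]; apply/Kf => i.
  by rewrite -gM fg.
Qed.

End TraceFormula.

(** * Signs in the Clifford algebra and their sums *)

Lemma set_card_ind (T : finType) (K : {set T} -> Prop) : K set0 ->
  (forall i (A : {set T}), i \notin A -> K A -> K (i |: A)) -> forall A, K A.
Proof.
move=> K0 KS A; elim: {A}#|A| {-2}A (erefl #|A|) => [|k IH] A.
  by move/cards0_eq->.
have [->|[i Ai]] := set_0Vmem A; first by rewrite cards0.
rewrite -(setD1K Ai) cardsU1 setD11 => -[cA].
by apply: KS; rewrite ?setD11 //; apply: IH.
Qed.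

Lemma symdiff1 (T : finType) (i : T) (A : {set T}) : i \notin A -> symdiff [set i] A = i |: A.
Proof.
move=> niA; apply/setP=> j; rewrite !inE.
by case: eqVneq => [->|] //=; rewrite (negPf niA).
Qed.

Section CliffordSigns.
Variables (R : realFieldType) (p q : nat).
Local Notation n := (p + q)%N.
Implicit Types A B : {set 'I_n}.
Local Notation sgn := (@clsign R p q).

Lemma clsign_sqr A B : sgn A B * sgn A B = 1.
Proof. by rewrite -clsignDl symdiffv clsign0l. Qed.

(** The sign relating e_i e_A and e_A e_i. *)
Lemma clsign1_comm i A :
  sgn [set i] A * sgn A [set i] = (-1) ^+ #|A :\ i|.
Proof.
rewrite /clsign big_set1.
under [X in _ * X]eq_bigr => j _ do rewrite big_set1.
rewrite -big_split /= -prodr_const.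
rewrite big_mkcond [RHS]big_mkcond; apply: eq_bigr => j _; rewrite !inE.
case: (j \in A); rewrite ?andbF // andbT /gensign eq_sym.
case: eqVneq => [->|nji] /=; first by rewrite mulrNN psgn_sq.
have /orP[lt|lt] : (i < j)%N || (j < i)%N.
- by rewrite -neq_ltn eq_sym.
- by rewrite lt ltnNge (ltnW lt) /= expr0 expr1 mul1r.
- by rewrite lt (ltnNge i) (ltnW lt) /= expr0 expr1 mulr1.
Qed.

(** The product of the squares e_i^2 = - psgn i for i in A. *)
Definition sqsign A : R := \prod_(i in A) - psgn R i.

(** The scalar e_A^2, where reversing e_A costs 'C(#|A|, 2) transpositions. *)
Lemma clsign_diag A : sgn A A = sqsign A * (-1) ^+ 'C(#|A|, 2).
Proof.
elim/set_card_ind: A => [|i A niA IH].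
  by rewrite clsign0l /sqsign big_set0 cards0 mulr1.
rewrite -{1 2}(symdiff1 niA) clsignDl !clsignDr.
have -> : sgn [set i] [set i] = - psgn R i by rewrite /clsign !big_set1 /gensign eqxx.
rewrite -mulrA [sgn [set i] A * _]mulrA clsign1_comm.
have -> : A :\ i = A by apply/setDidPl; rewrite disjoint_sym disjoints1.
rewrite IH cardsU1 niA binS bin1 exprD /sqsign big_setU1 //=.
by rewrite -!mulrA; congr (_ * _); rewrite mulrCA; congr (_ * _); rewrite mulrC.
Qed.

Lemma sqsignD A B : sqsign (symdiff A B) = sqsign A * sqsign B.
Proof.
rewrite /sqsign (big_mkcond (mem (symdiff A B))) (big_mkcond (mem A)).
rewrite (big_mkcond (mem B)) -big_split /=; apply: eq_bigr => i _.
rewrite inE; case: (i \in A); case: (i \in B) => /=; rewrite ?mulr1 ?mul1r //.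
by rewrite mulrNN psgn_sq.
Qed.

Lemma sqsign_sqr A : sqsign A * sqsign A = 1.
Proof. by rewrite -sqsignD symdiffv /sqsign big_set0. Qed.

Lemma odd_card_symdiff A B : odd #|symdiff A B| = odd #|A| (+) odd #|B|.
Proof.
have -> : #|symdiff A B| = (#|A :\: B| + #|B :\: A|)%N.
  rewrite -cardsUI; have -> : (A :\: B) :&: (B :\: A) = set0.
    by apply/setP=> i; rewrite !inE; case: (i \in A); case: (i \in B).
  rewrite cards0 addn0; congr #|pred_of_set _|.
  by apply/setP=> i; rewrite !inE; case: (i \in A); case: (i \in B).
rewrite oddD -(cardsID B A) -(cardsID A B) !oddD (setIC B A).
by case: (odd _); case: (odd _); case: (odd _).
Qed.

End CliffordSigns.

Section GaussSums.
Variables (R : rcfType) (p q : nat).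
Local Notation n := (p + q)%N.
Local Notation rRe := (@complex.Re R).
Local Notation rIm := (@complex.Im R).
Local Notation im := ('i%C : R[i]).
Implicit Types A B : {set 'I_n}.

Lemma exprC_period k : im ^+ k.+4 = im ^+ k.
Proof.
have i4 : im ^+ 4 = 1 by rewrite (exprM _ 2 2) sqr_i sqrrN expr1n.
by rewrite -addn4 exprD i4 mulr1.
Qed.

Lemma sign_bin2_period k : (-1) ^+ 'C(k.+4, 2) = (-1) ^+ 'C(k, 2) :> R.
Proof.
rewrite -signr_odd -[RHS]signr_odd; congr (_ ^+ _); rewrite !binS !bin1 !bin0.
lia.
Qed.

Lemma nat_ind4 (K : nat -> Prop) : K 0%N -> K 1%N -> K 2%N -> K 3%N ->
  (forall k, K k -> K k.+4) -> forall k, K k.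
Proof.
move=> K0 K1 K2 K3 KS k; rewrite (divn_eq k 4) addnC.
elim: (k %/ 4)%N => [|d]; last by rewrite mulSn addnCA; apply: KS.
by rewrite mul0n addn0; have := ltn_pmod k (isT : 0 < 4)%N; move: (k %% 4)%N => [|[|[|[|]]]].
Qed.

Lemma Re_exprC k : rRe ((1 - im) * im ^+ k) = (-1) ^+ 'C(k, 2).
Proof.
elim/nat_ind4: k => [||||k IH]; last by rewrite exprC_period IH sign_bin2_period.
- by rewrite expr0 mulr1 expr0 /= oppr0 addr0.
- by rewrite expr1 expr0; simpc.
- by rewrite sqr_i expr1 mulrN1 /= oppr0 addr0.
- by rewrite exprSr sqr_i /= -signr_odd expr1; simpc.
Qed.

Lemma Im_exprC k : rIm (im ^+ k) = if odd k then (-1) ^+ 'C(k, 2) else 0.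
Proof.
elim/nat_ind4: k => [||||k IH]; last first.
- by rewrite exprC_period IH sign_bin2_period /= !negbK.
- by rewrite exprSr sqr_i /= -signr_odd expr1; simpc.
- by rewrite sqr_i /= oppr0.
- by rewrite expr1.
- by rewrite expr0.
Qed.

(** The sign of e_A^2 is the real part of (1 - i) times the product of the
    i e_j^2 over j in A, and the sum over A of these products is the product of all
    the 1 + i e_j^2. *)
Lemma clsign_diag_sum :
  \sum_(A : {set 'I_n}) clsign R A A =
  rRe ((1 - im) * (1 - im) ^+ p * (1 + im) ^+ q).
Proof.
have ReZ k (z : R[i]) : rRe (k%:C%C * z) = k * rRe z by case: z => a b; simpc.
have prodE : (1 - im) ^+ p * (1 + im) ^+ q = \prod_(j < n) ((- psgn R j)%:C%C * im + 1).
  rewrite big_split_ord /= (eq_bigr (fun=> 1 - im)) => [|i _]; last first.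
    by rewrite /psgn /= ltn_ord addrC rmorphN1 mulN1r.
  rewrite [X in _ = _ * X](eq_bigr (fun=> 1 + im)) => [|i _]; last first.
    by rewrite /psgn /= ltnNge leq_addr /= opprK addrC rmorph1 mul1r.
  by rewrite !prodr_const !card_ord.
rewrite -mulrA prodE bigA_distr mulr_sumr raddf_sum.
apply: eq_bigr => A _ /=; rewrite clsign_diag -Re_exprC /sqsign.
rewrite -big_mkcond /= big_split /= prodr_const -rmorph_prod /=.
by rewrite mulrCA ReZ.
Qed.

Lemma odd_sign_sum N :
  \sum_(A : {set 'I_N} | odd #|A|) (-1) ^+ 'C(#|A|, 2) = rIm ((1 + im) ^+ N).
Proof.
have -> : (1 + im) ^+ N = \prod_(j < N) (im + 1).
  by rewrite prodr_const card_ord addrC.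
rewrite bigA_distr raddf_sum big_mkcond.
apply: eq_bigr => A _ /=.
by rewrite -big_mkcond /= prodr_const Im_exprC.
Qed.

End GaussSums.

(** * Clifford modules and their invariant symmetric forms *)

Section ModuleBasis.
Variables (R : realFieldType) (p q m : nat) (rho : clmodule R p q m).
Local Notation n := (p + q)%N.
Local Notation sgn := (@clsign R p q).
Implicit Types A B : {set 'I_n}.

(** The action of the basis element e_A on the module. *)
Definition bmx A : 'M[R]_m := rho (clbasis R A).

Lemma bmxM A B : bmx A *m bmx B = sgn A B *: bmx (symdiff A B).
Proof. by rewrite mulmxE /bmx -rmorphM /= clbasisM linearZ. Qed.

Lemma bmx0 : bmx set0 = 1%:M.
Proof. by rewrite /bmx clbasis0 rmorph1. Qed.

Lemma bmx_sq A : bmx A *m bmx A = (sgn A A)%:M.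
Proof. by rewrite bmxM symdiffv bmx0 scalemx1. Qed.

Lemma sgn1 (i : 'I_n) : sgn [set i] [set i] = - psgn R i.
Proof. by rewrite /clsign !big_set1 /gensign eqxx. Qed.

Lemma bmx_comm1 i A :
  bmx [set i] *m bmx A = (-1) ^+ #|A :\ i| *: (bmx A *m bmx [set i]).
Proof.
by rewrite !bmxM symdiffC scalerA -clsign1_comm -mulrA clsign_sqr mulr1.
Qed.

Lemma bmx_stable (U : {vspace 'cV[R]_m}) :
  (forall A s, s \in U -> bmx A *m s \in U) ->
  forall a s, s \in U -> rho a *m s \in U.
Proof.
move=> UA a s Us; rewrite (clbasis_sum a) linear_sum mulmx_suml.
by apply: memv_suml => A _; rewrite linearZ -scalemxAl memvZ // UA.
Qed.

(** The trace vanishes because e_i anticommutes with e_A. *)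
Lemma trace_bmx0 i A : odd #|A :\ i| -> \tr (bmx A) = 0.
Proof.
move=> oA; have e2 := bmx_sq [set i].
have : \tr (bmx A *m (bmx [set i] *m bmx [set i])) =
    - \tr (bmx A *m (bmx [set i] *m bmx [set i])).
  rewrite [X in \tr X = _]mulmxA [LHS]mxtrace_mulC [X in \tr X = _]mulmxA.
  have sA : (-1) ^+ #|A :\ i| = -1 :> R by rewrite -signr_odd oA.
  by rewrite (bmx_comm1 i A) sA scaleN1r mulNmx linearN -mulmxA.
rewrite e2 mul_mx_scalar linearZ /= sgn1 => /eqP.
rewrite -addr_eq0 -mulr2n mulrn_eq0 /= mulf_eq0 oppr_eq0.
case/orP=> /eqP // p0; have := psgn_sq R i; rewrite p0 mul0r => /esym/eqP.
by rewrite oner_eq0.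
Qed.

Lemma trace_bmx_even A : ~~ odd #|A| -> A != set0 -> \tr (bmx A) = 0.
Proof.
move=> eA /set0Pn[i iA]; apply: (@trace_bmx0 i).
by move: eA; rewrite (cardsD1 i) iA negbK.
Qed.

Lemma trace_bmx_proper A : odd #|A| -> A != [set: 'I_n] -> \tr (bmx A) = 0.
Proof.
move=> oA; rewrite -subTset => /subsetPn[i _ niA]; apply: (@trace_bmx0 i).
by move: oA; rewrite (cardsD1 i) (negPf niA).
Qed.

End ModuleBasis.

Section InvariantForm.
Variables (R : rcfType) (p q m : nat) (rho : clmodule R p q m).
Local Notation n := (p + q)%N.
Local Notation sgn := (@clsign R p q).
Local Notation E := (bmx rho).
Implicit Types A B : {set 'I_n}.

(** The sum of the pull-backs of the standard scalar product by all e_A; it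
    is positive definite and invariant under every e_A. *)
Definition invform : 'M[R]_m := \sum_A (E A)^T *m E A.

Lemma invform_sym : invform^T = invform.
Proof.
rewrite /invform raddf_sum; apply: eq_bigr => A _.
by rewrite /= trmx_mul trmxK.
Qed.

Lemma invformE B : (E B)^T *m invform *m E B = invform.
Proof.
rewrite /invform mulmx_sumr mulmx_suml.
rewrite [RHS](reindex_inj (can_inj (fun A => symdiffK B A))) /=; apply: eq_bigr => A _.
rewrite mulmxA -trmx_mul -mulmxA bmxM symdiffC linearZ /= linearZ /= -scalemxAl.
by rewrite scalerA clsign_sqr scale1r.
Qed.

Lemma gram_ge0 (v : 'cV[R]_m) : 0 <= (v^T *m v) 0 0.
Proof. by rewrite mxE sumr_ge0 // => i _; rewrite mxE -expr2 sqr_ge0. Qed.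

Lemma gram_eq0 (v : 'cV[R]_m) : (v^T *m v) 0 0 = 0 -> v = 0.
Proof.
rewrite mxE => /psumr_eq0P v0; apply/matrixP=> i j; rewrite (ord1 j) mxE.
apply/eqP; rewrite -sqrf_eq0 expr2.
by have := v0 (fun i _ => _) i isT; rewrite mxE => -> // k; rewrite mxE -expr2 sqr_ge0.
Qed.

Lemma invform_ge0 (v : 'cV[R]_m) : 0 <= (v^T *m invform *m v) 0 0.
Proof.
rewrite /invform mulmx_sumr mulmx_suml summxE sumr_ge0 // => A _.
by rewrite mulmxA -trmx_mul -mulmxA gram_ge0.
Qed.

Lemma invform_eq0 (v : 'cV[R]_m) : (v^T *m invform *m v) 0 0 = 0 -> v = 0.
Proof.
rewrite /invform mulmx_sumr mulmx_suml summxE => /psumr_eq0P v0.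
apply: gram_eq0.
rewrite -[v in v^T *m v]mul1mx -(bmx0 rho) trmx_mul.
have := v0 (fun A _ => _) set0 isT.
rewrite !mulmxA => -> // A.
by rewrite mulmxA -trmx_mul -mulmxA gram_ge0.
Qed.

Lemma invform_unit : invform \in unitmx.
Proof.
rewrite -row_free_unit -kermx_eq0; apply/eqP/row_matrixP => i.
have : row i (kermx invform) *m invform = 0 by apply/sub_kermxP/row_sub.
move: (row i _) => u u0; rewrite row0; apply: trmx_inj; rewrite trmx0.
by apply: invform_eq0; rewrite trmxK u0 mul0mx mxE.
Qed.

(** A complex eigenvalue a + b i of a real matrix, seen over the reals: the
    real or the imaginary part of an eigenvector is annihilated by
    (C - a)^2 + b^2. *)
Lemma real_quadratic_eigenvector (C : 'M[R]_m) : (0 < m)%N ->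
  exists a b (v : 'cV[R]_m), v != 0 /\
   (C - a%:M) *m ((C - a%:M) *m v) = - (b ^+ 2) *: v.
Proof.
move=> m0; pose CC := map_mx (real_complex R) C^T.
have [[a b] rz] : exists z, root (char_poly CC) z.
  by apply/closed_rootP; rewrite size_char_poly; case: m m0.
move: rz; rewrite -eigenvalue_root_char => /eigenvalueP[w wC w0].
pose x := \col_i complex.Re (w 0 i); pose y := \col_i complex.Im (w 0 i).
have wE i : \sum_j w 0 j * (C i j)%:C%C = (Complex a b) * w 0 i.
  have /rowP/(_ i) := wC; rewrite !mxE => <-.
  by apply: eq_bigr => j _; rewrite !mxE.
(* w = x + i y with C w = (a + b i) w, since CC is built from the transpose of C. *)
have Cx : (C - a%:M) *m x = - b *: y.
  apply/colP=> i; rewrite mulmxBl mul_scalar_mx !mxE.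
  have /(congr1 (@complex.Re R)) := wE i; rewrite raddf_sum /=.
  rewrite (eq_bigr (fun j => C i j * x j 0)) => [->|j _]; last first.
    by rewrite mxE; case: (w 0 j) => u v; simpc; rewrite /= mulrC.
  by case: (w 0 i) => u v; simpc => /=; ring.
have Cy : (C - a%:M) *m y = b *: x.
  apply/colP=> i; rewrite mulmxBl mul_scalar_mx !mxE.
  have /(congr1 (@complex.Im R)) := wE i; rewrite raddf_sum /=.
  rewrite (eq_bigr (fun j => C i j * y j 0)) => [->|j _]; last first.
    by rewrite mxE; case: (w 0 j) => u v; simpc; rewrite /= mulrC.
  by case: (w 0 i) => u v; simpc => /=; ring.
have [x0|x0] := eqVneq x 0; last first.
  exists a, b, x; split=> //; rewrite Cx -scalemxAr Cy scalerA; congr (_ *: _); ring.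
exists a, b, y; split.
  apply: contraNneq w0 => y0; apply/eqP/rowP=> i.
  have /colP/(_ i) := x0; have /colP/(_ i) := y0; rewrite !mxE.
  by case: (w 0 i) => u v /= -> ->.
by rewrite Cy -scalemxAr Cx scalerA; congr (_ *: _); ring.
Qed.

(** Symmetric invariant forms on an irreducible module are proportional,
    whatever the endomorphism algebra of the module is. *)
Lemma invform_unique (M : 'M[R]_m) : irreducible rho ->
  M^T = M -> (forall A, (E A)^T *m M *m E A = M) -> exists k, M = k *: invform.
Proof.
move=> [m0 irr] MT ME; pose H := invform; pose C := invmx H *m M.
(* C is self-adjoint for H; its complex eigenvalue a + b i is shown to be real. *)
have HC : H *m C = M by rewrite mulKVmx // invform_unit.
have [a [b [v [v0 qv]]]] := real_quadratic_eigenvector C m0.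
exists a; pose N := M - a *: H.
have NE : N = H *m (C - a%:M) by rewrite mulmxBr HC mul_mx_scalar.
have NT : N^T = N by rewrite linearB linearZ /= MT invform_sym.
pose w := (C - a%:M) *m v.
have wHw : (w^T *m H *m w) 0 0 = - b ^+ 2 * (v^T *m H *m v) 0 0.
  have -> : w^T *m H *m w = v^T *m H *m ((C - a%:M) *m w).
    have -> : w^T *m H = v^T *m N.
      by rewrite trmx_mul -mulmxA; congr (_ *m _); rewrite -NT NE trmx_mul invform_sym.
    by rewrite NE !mulmxA.
  by rewrite qv -scalemxAr mxE.
have w0 : w = 0.
  apply: invform_eq0; apply/eqP; rewrite eq_le invform_ge0 andbT wHw.
  by rewrite mulNr oppr_le0 mulr_ge0 ?sqr_ge0 ?invform_ge0.
pose U := lker (linfun (mulmx N : 'cV[R]_m -> 'cV[R]_m)).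
have memU s : (s \in U) = (N *m s == 0) by rewrite memv_ker lfunE.
have Nst A : (E A)^T *m N *m E A = N.
  by rewrite mulmxBr mulmxBl ME -scalemxAr -scalemxAl invformE.
(* The kernel of the invariant form N is a submodule containing v. *)
have [U0|Uf] : U = 0%VS \/ U = fullv.
  apply: irr; apply: bmx_stable => A s; rewrite !memU => /eqP Ns.
  have := congr1 (mulmx (E A)^T) (congr1 (mulmx^~ s) (Nst A)).
  rewrite Ns mulmx0 !mulmxA -trmx_mul bmx_sq tr_scalar_mx -!mulmxA mul_scalar_mx.
  move/eqP; rewrite scaler_eq0 => /orP[/eqP s0|//].
  by have /eqP := clsign_sqr R A A; rewrite s0 mul0r eq_sym oner_eq0.
  have : v \in U by rewrite memU NE -mulmxA -/w w0 mulmx0.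
  by rewrite U0 memv0 (negPf v0).
apply/eqP; rewrite -subr_eq0 -/N; apply/eqP/matrixP=> i j.
have : (delta_mx j 0 : 'cV_m) \in U by rewrite Uf memvf.
by rewrite memU -colE => /eqP/colP/(_ i); rewrite !mxE.
Qed.

End InvariantForm.

(** * The dimension of an irreducible module *)

Section SpinorDimension.
Variables (R : rcfType) (p q m : nat) (rho : clmodule R p q m).
Local Notation n := (p + q)%N.
Local Notation sgn := (@clsign R p q).
Local Notation E := (bmx rho).
Implicit Types A B : {set 'I_n}.

(** The transpose of M if b holds, and M otherwise. *)
Definition trc (b : bool) (M : 'M[R]_m) := if b then M^T else M.

Lemma trc_linear b : linear (trc b).
Proof. by case: b => k M N //=; rewrite linearD linearZ. Qed.

Lemma trc_conj b (X M : 'M[R]_m) : trc b (X^T *m M *m X) = X^T *m trc b M *m X.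
Proof. by case: b; rewrite //= !trmx_mul trmxK mulmxA. Qed.

Lemma trc_add b c (M : 'M[R]_m) : trc b (trc c M) = trc (b (+) c) M.
Proof. by case: b; case: c; rewrite //= trmxK. Qed.

Lemma conj_linear b k A : linear (fun M => k *: ((E A)^T *m trc b M *m E A)).
Proof.
move=> l M N; rewrite trc_linear mulmxDr mulmxDl -scalemxAr -scalemxAl.
by rewrite scalerDr !scalerA mulrC.
Qed.

Lemma conj_comp b c k l A B M :
  k *: ((E A)^T *m trc b (l *: ((E B)^T *m trc c M *m E B)) *m E A) =
  (k * l) *: ((E (symdiff A B))^T *m trc (b (+) c) M *m E (symdiff A B)).
Proof.
have trcZ d x (N : 'M[R]_m) : trc d (x *: N) = x *: trc d N.
  by case: d => //=; rewrite linearZ.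
rewrite trcZ trc_conj trc_add -scalemxAr -scalemxAl scalerA; congr (_ *: _).
rewrite !mulmxA -trmx_mul -[_ *m E B *m E A]mulmxA bmxM (symdiffC B).
by rewrite [(_ *: _)^T]linearZ -scalemxAr -!scalemxAl scalerA clsign_sqr scale1r.
Qed.

Lemma optrace_conj b k A :
  optrace (fun M => k *: ((E A)^T *m trc b M *m E A)) =
  k * (if b then sgn A A * m%:R else (\tr (E A)) ^+ 2).
Proof.
rewrite optraceZ; congr (_ * _); case: b => /=.
  by rewrite optrace_mul_tr trmxK bmx_sq mxtrace_scalar mulr_natr.
by rewrite optrace_mul mxtrace_tr expr2.
Qed.

Lemma card_sets (T : finType) : #|{set T}| = (2 ^ #|T|)%N.
Proof. by rewrite -cardsT -card_powerset powersetT !cardsT. Qed.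

(** The line of symmetric invariant forms is the fixed space of the operators
    M |-> E_A^T M E_A and of transposition, whose traces are summed here. *)
Lemma trace_sum : irreducible rho ->
  \sum_A \tr (E A) ^+ 2 + m%:R * \sum_A sgn A A = 2 ^+ n.+1.
Proof.
move=> irr; have [m0 _] := irr.
pose op (x y : {set 'I_n} * bool) := (symdiff x.1 y.1, x.2 (+) y.2).
pose f (x : {set 'I_n} * bool) M := 1 *: ((E x.1)^T *m trc x.2 M *m E x.1).
have cardI : #|{: {set 'I_n} * bool}|%:R = 2 ^+ n.+1 :> R.
  by rewrite card_prod card_sets card_ord card_bool -expnSr natrX.
have dK : \dim <[invform rho]> = 1%N.
  rewrite dim_vline; case: eqVneq => // H0.
  have := invform_unit rho; rewrite H0 -row_free_unit /row_free mxrank0.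
  by case: m m0.
have := @dim_fixed_family R m _ op f <[invform rho]>%VS.
rewrite cardI dK mul1r => -> //.
- rewrite mulr_sumr -big_split /=.
  transitivity (\sum_A (optrace (f (A, false)) + optrace (f (A, true)))).
    by apply: eq_bigr => A _; rewrite !optrace_conj !mul1r mulrC.
  rewrite -(pair_bigA _ (fun A b => optrace (f (A, b)))) /=.
  by apply: eq_bigr => A _; rewrite big_bool addrC.
- by rewrite expf_neq0 // pnatr_eq0.
- move=> [A b] [B c] [C d] [/(can_inj (symdiffK A)) -> ].
  by move/(can_inj (addKb b)) => ->.
- by move=> [A b]; apply: conj_linear.
- by move=> [A b] [B c] M; rewrite /f conj_comp mulr1.
move=> M; split=> [/vlineP[k ->] [A b]|fM].
  have trcH : trc b (k *: invform rho) = k *: invform rho.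
    by case: b => //=; rewrite linearZ /= invform_sym.
  by rewrite /f /= scale1r trcH -scalemxAr -scalemxAl invformE.
apply/vlineP; apply: invform_unique => //.
  by have := fM (set0, true); rewrite /f /= bmx0 trmx1 mul1mx mulmx1 scale1r.
by move=> A; have := fM (A, false); rewrite /f /= scale1r.
Qed.

(** The transpose of E_A is conjugate, through the invariant form, to its inverse. *)
Lemma trace_bmx_sgn A : \tr (E A) = sgn A A * \tr (E A).
Proof.
have H1 := invform_unit rho.
have EAT : (E A)^T = sgn A A *: (invform rho *m E A *m invmx (invform rho)).
  apply: (can_inj (mulmxK H1)); rewrite -scalemxAl mulmxKV //.
  have := congr1 (mulmx^~ (E A)) (invformE rho A).
  rewrite -mulmxA bmx_sq mul_mx_scalar => /(congr1 ( *:%R (sgn A A))).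
  by rewrite scalerA clsign_sqr scale1r.
by rewrite -[in LHS]mxtrace_tr EAT mxtraceZ -mulmxA mxtrace_mulC mulmxKV.
Qed.

(** This is 2 if the volume element e_1 ... e_n is central and has square 1,
    so that the Clifford algebra is a product of two ideals, and 1 otherwise. *)
Definition splitting : nat :=
  if odd n && (sgn [set: 'I_n] [set: 'I_n] == 1) then 2 else 1.

(** For n odd the volume element is central; if its square is 1 it acts on an
    irreducible module by 1 or - 1, and otherwise its trace is 0. *)
Lemma trace_volume : irreducible rho -> odd n ->
  \tr (E [set: 'I_n]) ^+ 2 =
  (if sgn [set: 'I_n] [set: 'I_n] == 1 then 1 else 0) * m%:R ^+ 2.
Proof.
move=> [m0 irr] odd_n; set T := [set: 'I_n]; case: eqP => [sT|sT]; last first.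
  have := trace_bmx_sgn T; move/eqP; rewrite -subr_eq0 -{1}[\tr _]mul1r -mulrBl.
  rewrite mulf_eq0 subr_eq0 eq_sym => /orP[/eqP //|/eqP->].
  by rewrite mul0r expr0n.
have ET2 : E T *m E T = 1%:M by rewrite bmx_sq sT.
have comT A : E A *m E T = E T *m E A.
  elim/set_card_ind: A => [|i A niA IH]; first by rewrite bmx0 mulmx1 mul1mx.
  have -> : E (i |: A) = sgn [set i] A *: (E [set i] *m E A).
    by rewrite bmxM symdiff1 // scalerA clsign_sqr scale1r.
  rewrite -scalemxAl -scalemxAr -mulmxA IH !mulmxA bmx_comm1.
  suff -> : (-1) ^+ #|T :\ i| = 1 :> R by rewrite scale1r.
  rewrite -signr_odd; have : odd #|T| by rewrite cardsT card_ord.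
  by rewrite (cardsD1 i) inE /= => /negPf->.
pose U := lker (linfun (mulmx (E T - 1%:M) : 'cV[R]_m -> 'cV[R]_m)).
have memU s : (s \in U) = (E T *m s == s).
  by rewrite memv_ker lfunE /= mulmxBl mul1mx subr_eq0.
suff [->|->] : E T = 1%:M \/ E T = - 1%:M.
- by rewrite mxtrace1 mul1r.
- by rewrite linearN /= mxtrace1 sqrrN mul1r.
have [U0|Uf] : U = 0%VS \/ U = fullv.
- apply: irr; apply: bmx_stable => A s; rewrite !memU => /eqP Ts.
  by rewrite mulmxA -comT -mulmxA Ts.
- right; apply/matrixP => i j.
  have : E T *m delta_mx j 0 + delta_mx j 0 \in U.
    by rewrite memU mulmxDr mulmxA ET2 mul1mx addrC.
  rewrite U0 memv0 -colE => /eqP/colP/(_ i); rewrite !mxE andbT => /eqP.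
  by rewrite addr_eq0 => /eqP.
- left; apply/matrixP => i j.
  have : (delta_mx j 0 : 'cV_m) \in U by rewrite Uf memvf.
  by rewrite memU -colE => /eqP/colP/(_ i); rewrite !mxE andbT.
Qed.

Lemma trace_sqr_sum : irreducible rho ->
  \sum_A \tr (E A) ^+ 2 = splitting%:R * m%:R ^+ 2.
Proof.
move=> irr; rewrite (bigD1 set0) //= bmx0 mxtrace1 /splitting.
have [n_odd|n_even] := boolP (odd n) => /=; last first.
  rewrite big1 ?addr0 ?mul1r // => A A0.
  have [oA|eA] := boolP (odd #|A|); last by rewrite trace_bmx_even // expr0n.
  rewrite trace_bmx_proper ?expr0n //; apply: contraNneq n_even => AT.
  by move: oA; rewrite AT cardsT card_ord.
rewrite (bigD1 [set: 'I_n]) /=; last first.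
  by rewrite -cards_eq0 cardsT card_ord; case: n n_odd.
rewrite big1 => [|A /andP[A0 AT]]; last first.
  have [oA|eA] := boolP (odd #|A|); first by rewrite trace_bmx_proper // expr0n.
  by rewrite trace_bmx_even // expr0n.
rewrite trace_volume // addr0; case: ifP => _; first by rewrite -[X in X + _]mul1r -mulrDl.
by rewrite mul0r addr0 mul1r.
Qed.

(** A quadratic equation that determines the dimension of an irreducible module. *)
Lemma spinor_dim : irreducible rho ->
  splitting%:R * m%:R ^+ 2 + m%:R * \sum_A sgn A A = 2 ^+ n.+1.
Proof. by move=> irr; rewrite -trace_sqr_sum // trace_sum. Qed.

End SpinorDimension.

(** * Bilinear forms defining equivariant maps *)

Section TwistedForms.
Variables (R : rcfType) (p q m : nat) (rho : clmodule R p q m).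
Local Notation n := (p + q)%N.
Local Notation sgn := (@clsign R p q).
Local Notation E := (bmx rho).
Implicit Types (A : {set 'I_n}) (M B : 'M[R]_m).
Variable (eps : R).
Hypothesis eps2 : eps * eps = 1.

Local Notation e i := (E [set i]).

(** The bilinear forms B with E_i^T B = eps B^T E_i for all i. *)
Definition twisted : {vspace 'M[R]_m} :=
  (\bigcap_(i < n) lker (linfun (mulmx (e i)^T)
     - eps *: (linfun (mulmxr (e i)) \o linfun trmx)%VF))%VS.

Lemma twistedP M :
  M \in twisted <-> forall i, (e i)^T *m M = eps *: (M^T *m e i).
Proof.
have mem_i i : (M \in lker (linfun (mulmx (e i)^T)
     - eps *: (linfun (mulmxr (e i)) \o linfun trmx)%VF))
   = ((e i)^T *m M == eps *: (M^T *m e i)).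
  rewrite memv_ker add_lfunE opp_lfunE scale_lfunE comp_lfunE.
  by rewrite !lfunE /= subr_eq0.
rewrite memvE /twisted; split=> [/subv_bigcapP MK i|MK].
  by apply/eqP; rewrite -mem_i memvE MK.
by apply/subv_bigcapP => i _; rewrite -memvE mem_i MK.
Qed.

Lemma bmx1_sq i : e i *m e i = - psgn R i *: 1%:M.
Proof. by rewrite bmx_sq sgn1 scalemx1. Qed.

Lemma bmx1_trsq i M : (e i)^T *m ((e i)^T *m M) = - psgn R i *: M.
Proof.
by rewrite mulmxA -trmx_mul bmx1_sq linearZ /= trmx1 -scalemxAl mul1mx.
Qed.

Lemma bmx1_sqr i M : M *m e i *m e i = - psgn R i *: M.
Proof. by rewrite -mulmxA bmx1_sq -scalemxAr mulmx1. Qed.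

Lemma anticomm1 i k : i != k -> e k *m e i = - (e i *m e k).
Proof.
move=> nik; rewrite bmx_comm1; suff -> : #|[set i] :\ k| = 1%N by rewrite expr1 scaleN1r.
by rewrite -(cards1 i) (cardsD1 k [set i]) inE eq_sym (negPf nik).
Qed.

(** The action of the subset A on bilinear forms, normalised so that it is a
    group action for the symmetric difference; by [twist1E] the forms in
    [twisted] are the ones fixed by all singletons. *)
Definition twist A M :=
  (eps ^+ odd #|A| * sqsign R A) *: ((E A)^T *m trc (odd #|A|) M *m E A).

Lemma twistM A (A' : {set 'I_n}) M : twist A (twist A' M) = twist (symdiff A A') M.
Proof.
rewrite /twist conj_comp odd_card_symdiff sqsignD mulrACA.
congr (_ * _ *: _); case: (odd _); case: (odd _) => /=.
all: by rewrite ?expr0 ?expr1 ?mul1r ?mulr1.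
Qed.

Lemma twist1E i M :
  twist [set i] M = M <-> (e i)^T *m M = eps *: (M^T *m e i).
Proof.
have pp := psgn_sq R i.
rewrite /twist cards1 expr1 /sqsign big_set1 /=; split=> [fM|MK].
  rewrite -[in LHS]fM -scalemxAr -mulmxA bmx1_trsq scalerA.
  by congr (_ *: _); rewrite -mulrA mulrNN pp mulr1.
have MT : M^T *m e i = eps *: ((e i)^T *m M).
  by rewrite MK scalerA eps2 scale1r.
rewrite -mulmxA MT -scalemxAr bmx1_trsq !scalerA.
rewrite [X in X *: _](_ : _ = (eps * eps) * (psgn R i * psgn R i)); last by ring.
by rewrite eps2 pp mulr1 scale1r.
Qed.

Lemma twistedE M : M \in twisted <-> forall A, twist A M = M.
Proof.
rewrite twistedP; split=> [MK A|MK i]; last by apply/twist1E.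
elim/set_card_ind: A => [|i A niA IH].
  rewrite /twist cards0 /sqsign big_set0 expr0 mulr1 scale1r /=.
  by rewrite bmx0 trmx1 mul1mx mulmx1.
by rewrite -symdiff1 // -twistM IH; apply/twist1E.
Qed.

Lemma dim_twisted :
  (\dim twisted)%:R * 2 ^+ n =
  m%:R ^+ 2 + eps * m%:R *
    \sum_(A : {set 'I_n} | odd #|A|) (-1) ^+ 'C(#|A|, 2).
Proof.
have card2 : #|{set 'I_n}|%:R = 2 ^+ n :> R by rewrite card_sets card_ord natrX.
have := @dim_fixed_family R m _ (@symdiff _) twist twisted.
rewrite card2 => ->.
- rewrite (bigID (fun A => odd #|A|)) /= addrC; congr (_ + _).
    rewrite (bigD1 set0) ?cards0 //= big1 => [|A /andP[eA A0]].
      rewrite addr0 optrace_conj /sqsign big_set0 cards0 expr0 !mul1r.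
      by rewrite bmx0 mxtrace1.
    by rewrite optrace_conj (negPf eA) trace_bmx_even // expr0n mulr0.
  rewrite mulr_sumr; apply: eq_bigr => A oA.
  rewrite optrace_conj oA expr1 clsign_diag mulrA -[eps * _ * _]mulrA mulrA.
  rewrite -[eps * _ * _ * _]mulrA; have := sqsign_sqr R A; set x := sqsign R A => xx.
  by rewrite -!mulrA; congr (_ * _); rewrite mulrA xx mul1r mulrC.
- by rewrite expf_neq0 // pnatr_eq0.
- by move=> A; apply: (can_inj (symdiffK A)).
- by move=> A; apply: conj_linear.
- exact: twistM.
- exact: twistedE.
Qed.

Section EquivariantMaps.
Variable W : {vspace 'M[R]_m}.
Hypothesis memW : forall M, (M \in W) = (M^T == eps *: M).

(** The map j to V with <v, j(s, t)> = B(v s, t). The tensor s (x) t is the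
    matrix s t^T, on which the bilinear form of matrix F takes the value
    tr(F^T s t^T); here F = E_i^T B, and dualising V puts the sign psgn i. *)
Definition form_map_fun (B : 'M[R]_m) (w : subvs_of W) : 'cV[R]_n :=
  \col_i (psgn R i * \tr (B^T *m e i *m vsval w)).

Lemma form_map_fun_linear B : linear (form_map_fun B).
Proof.
move=> k u v; apply/colP => i; rewrite !mxE linearP /= linearP /=; ring.
Qed.

HB.instance Definition _ B :=
  GRing.isLinear.Build R _ _ _ (form_map_fun B) (form_map_fun_linear B).

Definition form_map (B : 'M[R]_m) : 'Hom(subvs_of W, 'cV[R]_n) :=
  linfun (form_map_fun B).

Lemma form_mapE B w i : form_map B w i 0 = psgn R i * \tr (B^T *m e i *m vsval w).
Proof. by rewrite lfunE mxE. Qed.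

Lemma form_map_linear : linear form_map.
Proof.
move=> k B C; apply/lfunP => w; apply/colP => i.
rewrite add_lfunE scale_lfunE !mxE !form_mapE linearD linearZ /=.
by rewrite !mulmxDl linearD -!scalemxAl linearZ /= mulrDr mulrCA.
Qed.

HB.instance Definition _ :=
  GRing.isLinear.Build R _ _ _ form_map form_map_linear.

Lemma mxtrace_gram_eq0 M : \tr (M^T *m M) = 0 -> M = 0.
Proof.
have gramE i : (M^T *m M) i i = ((col i M)^T *m col i M) 0 0.
  by rewrite !mxE; apply: eq_bigr => j _; rewrite !mxE.
move=> M0; apply/matrixP=> k i; rewrite mxE.
have /gram_eq0/colP/(_ k) : ((col i M)^T *m col i M) 0 0 = 0; last by rewrite !mxE.
rewrite -gramE; apply: (psumr_eq0P _ M0) => // j _.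
by rewrite gramE gram_ge0.
Qed.

Lemma twisted_formW B i : B \in twisted -> (e i)^T *m B \in W.
Proof.
by move/twistedP=> BK; rewrite memW trmx_mul trmxK BK scalerA eps2 scale1r.
Qed.

Lemma form_map_inj B : (0 < n)%N -> B \in twisted -> form_map B = 0 -> B = 0.
Proof.
move=> n0 BK jB0; pose i0 := Ordinal n0.
have FW := twisted_formW i0 BK.
have : (e i0)^T *m B = 0.
  apply: mxtrace_gram_eq0; apply/eqP.
  have /colP/(_ i0) : form_map B (vsproj W ((e i0)^T *m B)) = 0.
    by rewrite jB0 zero_lfunE.
  rewrite form_mapE mxE vsprojK // trmx_mul trmxK.
  move/eqP; rewrite mulf_eq0 => /orP[/eqP p0|//].
  by have /eqP := psgn_sq R i0; rewrite p0 mul0r eq_sym oner_eq0.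
move/(congr1 (mulmx (e i0)^T)); rewrite bmx1_trsq mulmx0 => /eqP.
rewrite scaler_eq0 oppr_eq0 => /orP[/eqP p0|/eqP //].
by have /eqP := psgn_sq R i0; rewrite p0 mul0r eq_sym oner_eq0.
Qed.

Lemma twisted_skew_gen B i k : B \in twisted -> i != k ->
  (e i *m e k)^T *m B = - (B *m (e i *m e k)).
Proof.
move/twistedP=> BK nik; have pp := psgn_sq R k.
have BE : B = - (eps * psgn R k) *: ((e k)^T *m B^T *m e k).
  have /twist1E := BK k; rewrite /twist cards1 expr1 /sqsign big_set1 /= => fB.
  by rewrite -[LHS]fB mulrN.
rewrite trmx_mul -mulmxA BK -scalemxAr [in RHS]BE -scalemxAl -!mulmxA.
rewrite (mulmxA (e k) (e i)) anticomm1 // mulNmx -mulmxA bmx1_sq -!scalemxAr mulmx1.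
rewrite -[- (- psgn R k *: e i)]scaleNr opprK -!scalemxAr -scaleNr opprK scalerA.
congr (_ *: _).
transitivity (eps * (psgn R k * psgn R k)); first by rewrite pp mulr1.
ring.
Qed.

Lemma so_anti (A : 'M[R]_n) i k : so A -> psgn R k * A k i + psgn R i * A i k = 0.
Proof.
move=> soA; have := soA (delta_mx i 0) (delta_mx k 0).
by rewrite pformC !pform_delta -!colE !mxE.
Qed.

Lemma so_diag (A : 'M[R]_n) i : so A -> A i i = 0.
Proof.
move=> soA; have /eqP := so_anti i i soA; rewrite -mulr2n mulrn_eq0 /= mulf_eq0.
case/orP=> /eqP // p0; have /eqP := psgn_sq R i.
by rewrite p0 mul0r eq_sym oner_eq0.
Qed.

Lemma rho_cliota (v : 'cV[R]_n) : rho (cliota v) = \sum_k v k 0 *: e k.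
Proof. by rewrite /cliota linear_sum; apply: eq_bigr => k _; rewrite linearZ. Qed.

(** The forms in [twisted] are invariant under the Lie algebra spin(V). *)
Lemma twisted_skew (A : 'M[R]_n) B : so A -> B \in twisted ->
  (rho (spinlift A))^T *m B = - (B *m rho (spinlift A)).
Proof.
move=> soA BK; rewrite spinliftE // linearZ linear_sum /= linearZ raddf_sum /=.
rewrite -scalemxAl -scalemxAr -scalerN; congr (_ *: _).
rewrite mulmx_suml mulmx_sumr -sumrN; apply: eq_bigr => i _.
rewrite linearZ /= rmorphM /= cliota_delta rho_cliota -mulmxE mulmx_sumr.
rewrite [in LHS]linearZ /= -scalemxAl -scalemxAr -scalerN; congr (_ *: _).
rewrite raddf_sum mulmx_suml mulmx_sumr -sumrN; apply: eq_bigr => k _ /=.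
rewrite -colE mxE -scalemxAr [in LHS]linearZ /= -scalemxAl -scalemxAr -scalerN.
have [<-|nik] := eqVneq i k; first by rewrite so_diag // !scale0r.
by congr (_ *: _); apply: twisted_skew_gen.
Qed.

Lemma tens_actW X M : M \in W -> tens_act X M \in W.
Proof.
rewrite !memW => /eqP MW.
rewrite /tens_act linearD /= !trmx_mul trmxK MW -scalemxAl -scalemxAr addrC.
by rewrite scalerDr.
Qed.

(** By invariance of B, moving a = spinlift A across B(v s, t) leaves B([v, a] s, t). *)
Lemma form_map_equivariant B : B \in twisted -> equivariant rho (form_map B).
Proof.
move=> BK A w soA; have wW := subvsP w; move: (vsval w) (vsvalK w) wW => M <- MW.
set X := rho (spinlift A).
have XB : X^T *m B = - (B *m X) by apply: twisted_skew.
have BX : X^T *m B^T = - (B^T *m X).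
  have := congr1 trmx XB; rewrite linearN /= !trmx_mul trmxK => ->.
  by rewrite opprK.
apply/colP => i; rewrite form_mapE vsprojK ?tens_actW // mxE.
have -> : \tr (B^T *m e i *m tens_act X M)
    = - \tr (B^T *m rho (cliota (A *m delta_mx i 0)) *m M).
  rewrite /tens_act mulmxDr linearD /= !mulmxA [X in _ + X]mxtrace_mulC !mulmxA.
  rewrite BX -spinlift_ad // rmorphB !rmorphM /= cliota_delta -!mulmxE -/X -/(e i).
  by rewrite mulmxBr mulmxBl linearB opprB /= !mulmxA !mulNmx linearN.
rewrite rho_cliota mulmx_sumr mulmx_suml [\tr _]raddf_sum mulrN mulr_sumr -sumrN.
apply: eq_bigr => k _; rewrite form_mapE vsprojK //= -colE mxE.
rewrite -scalemxAr -scalemxAl linearZ /= !mulrA -mulNr; congr (_ * _).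
have Aik : A i k = - (psgn R i * (psgn R k * A k i)).
  have /eqP := so_anti i k soA; rewrite addr_eq0 => /eqP->.
  by rewrite mulrN opprK mulrA psgn_sq mul1r.
rewrite Aik !mulNr -!mulrA; congr (- (_ * _)).
by rewrite mulrCA psgn_sq mulr1.
Qed.

End EquivariantMaps.

End TwistedForms.

(** * Every equivariant map comes from a bilinear form *)

Section Rotations.
Variables (R : realFieldType) (p q : nat).
Local Notation n := (p + q)%N.

(** The element v |-> <e_l, v> e_k - <e_k, v> e_l of so(V). *)
Definition rotation (k l : 'I_n) : 'M[R]_n :=
  psgn R l *: delta_mx k l - psgn R k *: delta_mx l k.

Lemma rotationE k l (v : 'cV[R]_n) : rotation k l *m v =
  (psgn R l * v l 0) *: delta_mx k 0 - (psgn R k * v k 0) *: delta_mx l 0.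
Proof.
have deltaE (i j : 'I_n) : delta_mx i j *m v = v j 0 *: delta_mx i 0.
  apply/colP=> a; rewrite !mxE (bigD1 j) //= big1 => [|b nb].
    by rewrite !mxE !eqxx andbT addr0 mulrC.
  by rewrite mxE (negPf nb) andbF mul0r.
by rewrite /rotation mulmxBl -!scalemxAl !deltaE !scalerA.
Qed.

Lemma so_rotation k l : so (rotation k l).
Proof.
have pformE c d i j (w : 'cV[R]_n) :
    pform (c *: delta_mx i 0 - d *: delta_mx j 0) w =
    c * (psgn R i * w i 0) - d * (psgn R j * w j 0).
  rewrite -!pform_delta /pform !mulr_sumr -sumrB; apply: eq_bigr => a _.
  by rewrite !mxE; ring.
by move=> v w; rewrite (pformC v) !rotationE !pformE; ring.
Qed.

Lemma spinlift_rotation k l : k != l ->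
  spinlift (rotation k l) = - 2%:R^-1 *: (clbasis R [set k] * clbasis R [set l]).
Proof.
move=> nkl; rewrite spinliftE; last exact: so_rotation.
have term i : psgn R i *: (cliota (delta_mx i 0) * cliota (rotation k l *m delta_mx i 0))
   = (if i == l then clbasis R [set l] * clbasis R [set k] else 0)
   - (if i == k then clbasis R [set k] * clbasis R [set l] else 0).
  rewrite rotationE [cliota (_ - _)]linearB /= mulrBr ![cliota (_ *: _)]linearZ /=.
  rewrite !cliota_delta !mxE !andbT.
  rewrite -!scalerAr scalerBr !scalerA [l == i]eq_sym [k == i]eq_sym.
  congr (_ - _); case: eqVneq => [->|_]; rewrite ?mulr0 ?scale0r //.
  - by rewrite mulr1 psgn_sq scale1r.
  - by rewrite mulr1 psgn_sq scale1r.
rewrite (eq_bigr _ (fun i _ => term i)) sumrB -!big_mkcond /= !big_pred1_eq.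
have anti : clbasis R [set l] * clbasis R [set k] = - (clbasis R [set k] * clbasis R [set l]).
  apply/eqP; rewrite -addr_eq0 -!cliota_delta cliotaM_sym pform_delta mxE.
  by rewrite eq_sym in nkl; rewrite (negPf nkl) !mulr0 scale0r oppr0.
rewrite anti -opprD -mulr2n -scaler_nat scalerN scalerA -scaleNr; congr (_ *: _).
by field.
Qed.
End Rotations.

Section FormsOfMaps.
Variables (R : rcfType) (p q m : nat) (rho : clmodule R p q m).
Local Notation n := (p + q)%N.
Local Notation E := (bmx rho).
Implicit Types (M B : 'M[R]_m).
Variable (eps : R).
Hypothesis eps2 : eps * eps = 1.
Local Notation e i := (E [set i]).
Variable W : {vspace 'M[R]_m}.
Hypothesis memW : forall M, (M \in W) = (M^T == eps *: M).

Lemma trace_form_inj M M' : M \in W -> M' \in W ->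
  (forall N, N \in W -> \tr (M^T *m N) = \tr (M'^T *m N)) -> M = M'.
Proof.
move=> WM WM' eqM; apply/eqP; rewrite -subr_eq0; apply/eqP.
apply: mxtrace_gram_eq0; rewrite [X in X *m _]linearB /= mulmxBl linearB /=.
by rewrite eqM ?subrr // memvB.
Qed.

(** Linear forms on W are represented by elements of W through the trace form. *)
Lemma trace_form_repr (f : {linear subvs_of W -> R^o}) :
  exists2 F, F \in W & forall w, f w = \tr (F^T *m vsval w).
Proof.
pose S M := 2%:R^-1 *: (M + eps *: M^T).
have SW M : M \in W -> S M = M.
  rewrite memW /S => /eqP->; rewrite scalerA eps2 scale1r -mulr2n -scaler_nat.
  by rewrite scalerA mulVf ?scale1r // pnatr_eq0.
have ST M : S M^T = eps *: S M.
  rewrite /S trmxK [RHS]scalerA [eps * _]mulrC -scalerA; congr (_ *: _).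
  by rewrite scalerDr scalerA eps2 scale1r addrC.
have WS M : S M \in W.
  by rewrite memW -ST /S [X in X == _]linearZ linearD linearZ /= trmxK.
have S_lin : linear S.
  by move=> k M N; apply/matrixP=> i j; rewrite !mxE; ring.
pose g M : R^o := f (vsproj W (S M)).
have g_lin : linear g by move=> k M N; rewrite /g S_lin !linearP.
pose gL : {linear 'M[R]_m -> R^o} :=
  HB.pack g (GRing.isLinear.Build _ _ _ _ g g_lin).
pose F := \matrix_(i, j) g (delta_mx i j).
exists F.
  rewrite memW; apply/eqP/matrixP=> i j; rewrite !mxE /g.
  by rewrite -trmx_delta ST linearZ /= linearZ.
move=> w; have -> : f w = g (vsval w) by rewrite /g SW ?subvsP ?vsvalK.
rewrite [in LHS](matrix_sum_delta (vsval w)) -[g]/(gL : _ -> _) linear_sum.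
rewrite /mxtrace [RHS](eq_bigr (fun i => \sum_j F j i * vsval w j i)) => [|i _].
  rewrite exchange_big; apply: eq_bigr => i _; rewrite linear_sum.
  by apply: eq_bigr => j _; rewrite linearZ /= mxE mulrC.
by rewrite mxE; apply: eq_bigr => j _; rewrite mxE.
Qed.

(** For F_i the matrix of the i-th component of j, lowered by the metric,
    equivariance under plane rotations makes the form E_i^-T F_i independent
    of i; this common form is B. *)
Lemma form_map_surj (j : 'Hom(subvs_of W, 'cV[R]_n)) : (0 < n)%N ->
  equivariant rho j -> exists2 B, B \in twisted rho eps & j = form_map rho W B.
Proof.
move=> n0 jE.
have [F FW jF] : exists2 F : 'I_n -> 'M[R]_m, forall i, F i \in W &
    forall i w, j w i 0 = psgn R i * \tr ((F i)^T *m vsval w).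
  have repr i : exists F, F \in W /\ forall w, j w i 0 = psgn R i * \tr (F^T *m vsval w).
    have lin_i : linear (fun w => psgn R i * j w i 0 : R^o).
      by move=> k u v; rewrite linearP !mxE /GRing.scale /=; ring.
    pose f : {linear subvs_of W -> R^o} := HB.pack (fun w => psgn R i * j w i 0 : R^o)
      (GRing.isLinear.Build _ _ _ _ _ lin_i).
    have [F FW fF] := trace_form_repr f; exists F; split=> // w.
    by rewrite -fF /= mulrA psgn_sq mul1r.
  have [F FP] := boolp.choice repr.
  by exists F => i; [case: (FP i) | case: (FP i)].
have FT i : (F i)^T = eps *: F i by apply/eqP; rewrite -memW.
(* Equivariance under the rotation in the plane of e_k and e_l, at e_l. *)
have relF k l : k != l ->
    (e k *m e l)^T *m F l + F l *m (e k *m e l) = (2%:R * psgn R l) *: F k.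
  move=> nkl; have [Y YE] : {Y | Y = e k *m e l} by eexists.
  rewrite -YE; apply: trace_form_inj; first last.
  - move=> N NW; have := jE _ (vsproj W N) (@so_rotation R p q k l).
    rewrite spinlift_rotation // rotationE vsprojK // => /colP/(_ l).
    have rhoE : rho (- 2%:R^-1 *: (clbasis R [set k] * clbasis R [set l]))
      = - 2%:R^-1 *: Y by rewrite linearZ /= rmorphM YE.
    rewrite !mxE eqxx [l == k]eq_sym (negPf nkl) eqxx /= mulr0 add0r mulr1 !jF.
    rewrite rhoE !vsprojK ?(tens_actW memW) // mulrA psgn_sq mul1r.
    have -> : \tr ((F l)^T *m tens_act (- 2%:R^-1 *: Y) N)
        = - 2%:R^-1 * \tr ((Y^T *m F l + F l *m Y)^T *m N).
      rewrite /tens_act [(_ *: Y)^T]linearZ /= -scalemxAl -scalemxAr -scalerDr.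
      rewrite -scalemxAr mxtraceZ mulmxDr linearD /= !mulmxA; congr (_ * _).
      rewrite linearD /= [(Y^T *m F l)^T]trmx_mul [(F l *m Y)^T]trmx_mul trmxK.
      rewrite mulmxDl linearD /=; congr (_ + _).
      by rewrite mxtrace_mulC mulmxA.
    rewrite [(_ *: F k)^T]linearZ /= -scalemxAl mxtraceZ => H.
    rewrite -[\tr ((F k)^T *m N)]opprK -H -[LHS]mul1r -[X in X * _ = _](psgn_sq R l).
    by field.
  - by rewrite memvZ.
  - rewrite memW linearD /= !trmx_mul !trmxK FT -!scalemxAl -!scalemxAr.
    by rewrite addrC scalerDr.
(* Let L be left multiplication by the transpose of Y = e_k e_l and R right
   multiplication by Y; they commute and have the same square. The relation for
   (l, k) makes F l a multiple of (L + R) (F k), so (L - R) (F l) = 0, and the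
   relation for (k, l) becomes L (F l) = psgn l F k. *)
have FE k l : k != l -> F k = psgn R l *: ((e k *m e l)^T *m F l).
  move=> nkl; have rkl := relF k l nkl; have := relF l k.
  rewrite eq_sym => /(_ nkl).
  have elk : e l *m e k = - (e k *m e l) by apply: anticomm1.
  rewrite elk; have [Y YE] : {Y | Y = e k *m e l} by eexists.
  rewrite -!YE in rkl *.
  have kk := psgn_sq R k; have ll := psgn_sq R l.
  have Y2 : Y *m Y = - (psgn R k * psgn R l) *: 1%:M.
    rewrite {1}YE -mulmxA YE [e l *m _]mulmxA elk mulNmx mulmxN !mulmxA bmx1_sqr.
    by rewrite bmx1_sq scalerA -scaleNr; congr (_ *: _); ring.
  have YY M : M *m Y *m Y = - (psgn R k * psgn R l) *: M.
    by rewrite -mulmxA Y2 -scalemxAr mulmx1.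
  have YYT M : Y^T *m (Y^T *m M) = - (psgn R k * psgn R l) *: M.
    by rewrite mulmxA -trmx_mul Y2 linearZ /= trmx1 -scalemxAl mul1mx.
  rewrite linearN /= mulNmx mulmxN -opprD => H.
  have comm : Y^T *m F l = F l *m Y.
    have k0 : 2%:R * psgn R k != 0.
      rewrite mulf_neq0 ?pnatr_eq0 //; apply: contra_eq_neq kk => ->.
      by rewrite mul0r eq_sym oner_eq0.
    apply: (scalerI k0); rewrite scalemxAr scalemxAl -H mulNmx mulmxN mulmxDl mulmxDr.
    by rewrite YY YYT mulmxA addrC.
  have -> : Y^T *m F l = psgn R l *: F k.
    apply: (scalerI (_ : 2%:R != 0 :> R)); first by rewrite pnatr_eq0.
    by rewrite scaler_nat mulr2n {2}comm rkl scalerA.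
  by rewrite scalerA ll scale1r.
(* B is the form B(s, t) = F(i0)(e_i0^-1 s, t), whose choice of i0 is immaterial. *)
pose i0 := Ordinal n0.
pose B := - psgn R i0 *: ((e i0)^T *m F i0).
have eB i : (e i)^T *m B = F i.
  rewrite /B -scalemxAr; have [->|ni] := eqVneq i i0.
    by rewrite bmx1_trsq scalerA mulrNN psgn_sq scale1r.
  rewrite (FE i i0) // mulmxA -trmx_mul anticomm1 // linearN /= mulNmx.
  by rewrite scalerN scaleNr opprK.
have eBT i : B^T *m e i = (F i)^T by rewrite -eB trmx_mul trmxK.
exists B.
  by apply/twistedP => i; rewrite eBT eB FT scalerA eps2 scale1r.
apply/lfunP => w; apply/colP => i; rewrite form_mapE jF.
by rewrite eBT.
Qed.

Lemma equivariant_space : (0 < n)%N ->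
  exists2 U : {vspace 'Hom(subvs_of W, 'cV[R]_n)},
    forall j, j \in U <-> equivariant rho j & \dim U = \dim (twisted rho eps).
Proof.
move=> n0; exists (linfun (form_map rho W) @: twisted rho eps)%VS.
  move=> j; split=> [/memv_imgP[B BK ->]|/(form_map_surj n0)[B BK ->]].
    by rewrite lfunE; apply: (form_map_equivariant eps2 memW BK).
  by rewrite -[form_map _ _ _]lfunE memv_img.
apply: limg_dim_eq; apply/eqP; rewrite -subv0; apply/subvP => B.
rewrite memv_cap memv_ker lfunE /= memv0 => /andP[BK /eqP B0].
by apply/eqP/(form_map_inj eps2 memW n0 BK B0).
Qed.

End FormsOfMaps.

(** * Existence of irreducible modules *)

Section LeftIdealModule.
Variables (R : realFieldType) (p q : nat).
Local Notation Cl := (clifford R p q).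

Definition left_ideal (U : {vspace Cl}) := forall a u : Cl, u \in U -> a * u \in U.

Section Action.
Variable U : {vspace Cl}.
Hypothesis idealU : left_ideal U.
Local Notation d := (\dim U).
Local Notation X := (vbasis U).

(** The element of the left ideal U with coordinates v in the chosen basis. *)
Definition ideal_vec (v : 'cV[R]_d) : Cl := \sum_j v j 0 *: X`_j.

Lemma ideal_vec_linear : linear ideal_vec.
Proof.
move=> k u v; rewrite /ideal_vec scaler_sumr -big_split; apply: eq_bigr => j _.
by rewrite !mxE scalerDl scalerA.
Qed.
HB.instance Definition _ := GRing.isLinear.Build R _ _ _ ideal_vec ideal_vec_linear.

Lemma ideal_vec_inj : injective ideal_vec.
Proof.
move=> u v uv; apply/colP => i.
have /freeP freeX := basis_free (vbasisP U).
apply/eqP; rewrite -subr_eq0; apply/eqP.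
apply: (freeX (fun i => u i 0 - v i 0)).
rewrite (eq_bigr (fun j => u j 0 *: X`_j - v j 0 *: X`_j)) => [|j _].
  by rewrite sumrB -!/(ideal_vec _) uv subrr.
by rewrite scalerBl.
Qed.

(** The matrix of left multiplication by a on the left ideal U. *)
Definition ideal_rep_fun (a : Cl) : 'M[R]_d :=
  \matrix_(i, j) coord X i (a * X`_j).

Lemma ideal_rep_vec a v : ideal_vec (ideal_rep_fun a *m v) = a * ideal_vec v.
Proof.
rewrite /ideal_vec mulr_sumr.
transitivity (\sum_i \sum_j v j 0 *: (coord X i (a * X`_j) *: X`_i)).
  apply: eq_bigr => i _; rewrite mxE scaler_suml; apply: eq_bigr => j _.
  by rewrite mxE scalerA mulrC.
rewrite exchange_big; apply: eq_bigr => j _ /=.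
rewrite -scaler_sumr -scalerAr -coord_vbasis //.
by apply: idealU; rewrite vbasis_mem // mem_nth // size_tuple.
Qed.

Lemma mx_ext (M N : 'M[R]_d) : (forall v : 'cV[R]_d, M *m v = N *m v) -> M = N.
Proof.
move=> MN; apply/matrixP=> i j; have /colP/(_ i) := MN (delta_mx j 0).
by rewrite -!colE !mxE.
Qed.

Lemma ideal_rep_linear : linear ideal_rep_fun.
Proof.
move=> k a b; apply: mx_ext => v; apply: ideal_vec_inj.
rewrite mulmxDl -scalemxAl linearD linearZ /= !ideal_rep_vec.
by rewrite mulrDl scalerAl.
Qed.

Lemma ideal_rep_monoid : monoid_morphism ideal_rep_fun.
Proof.
split=> [|a b]; apply: mx_ext => v; apply: ideal_vec_inj.
  by rewrite ideal_rep_vec mul1r mul1mx.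
by rewrite -mulmxE -mulmxA !ideal_rep_vec mulrA.
Qed.

HB.instance Definition _ :=
  GRing.isLinear.Build R Cl 'M[R]_d _ ideal_rep_fun ideal_rep_linear.
HB.instance Definition _ :=
  GRing.isMonoidMorphism.Build Cl 'M[R]_d ideal_rep_fun ideal_rep_monoid.

Definition ideal_rep : clmodule R p q d := ideal_rep_fun.

(** The module given by a left ideal of minimal positive dimension is irreducible. *)
Lemma ideal_rep_irreducible : U != 0%VS ->
  (forall V, left_ideal V -> V != 0%VS -> (d <= \dim V)%N) -> irreducible ideal_rep.
Proof.
move=> U0 minU; split=> [|V stV]; first by rewrite lt0n dimv_eq0.
have [->|V0] := eqVneq V 0%VS; [by left | right].
have dimV : \dim (linfun ideal_vec @: V) = \dim V.
  apply: limg_dim_eq; apply/eqP; rewrite -subv0; apply/subvP => v.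
  rewrite memv_cap memv_ker lfunE /= => /andP[_].
  by rewrite -(linear0 ideal_vec) => /eqP/ideal_vec_inj->; rewrite mem0v.
apply/eqP; rewrite eqEdim subvf dimvf /= -dimV.
apply: leq_trans (_ : d <= _)%N; first by rewrite /dim /= muln1.
apply: minU; last by rewrite -dimv_eq0 dimV dimv_eq0.
move=> a _ /memv_imgP[v Vv ->]; rewrite lfunE /= -ideal_rep_vec.
by rewrite -[ideal_vec _]lfunE memv_img // stV.
Qed.

End Action.

Lemma irreducible_exists : exists m (rho : clmodule R p q m), irreducible rho.
Proof.
pose P d := `[< exists U, [/\ left_ideal U, U != 0%VS & \dim U = d] >].
have exP : exists d, P d.
  exists (\dim {:Cl}); apply/asboolP; exists fullv; split=> //.
    by move=> a u _; rewrite memvf.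
  by apply: contraNneq (clunit_neq0 R p q) => f0; rewrite -memv0 -f0 memvf.
case: (ex_minnP exP) => d /asboolP[U [idU U0 dU]] min_d.
exists (\dim U), (ideal_rep idU); apply: ideal_rep_irreducible => // V idV V0.
by rewrite dU; apply: min_d; apply/asboolP; exists V.
Qed.

End LeftIdealModule.

From mathcomp Require Import classical_sets functions cardinality reals.

(** * The dimensions in terms of an eighth root of unity *)

(** The volume element is central of square 1 exactly when p - q, which is
    congruent to p + 3 q, is 3 modulo 4. *)
Lemma splitting_parity (p q : nat) :
  odd (p + q) && ~~ odd (p + 'C(p + q, 2)) = ((p + 3 * q) %% 4 == 3)%N.
Proof.
have binS4 k : odd 'C(k.+4, 2) = odd 'C(k, 2) by rewrite !binS !bin1 !bin0; lia.
elim/nat_ind4: p q => [||||p IH] q; last first.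
  by move: (IH q) (binS4 (p + q)%N); rewrite -[(p.+4 + q)%N]/((p + q).+4);
    move: 'C((p + q).+4, 2) 'C(p + q, 2) => c c'; lia.
all: elim/nat_ind4: q => [||||q IH] //; move: IH.
- by move: (binS4 (3 + q)%N); rewrite -[(3 + q.+4)%N]/((3 + q).+4);
    move: 'C((3 + q).+4, 2) 'C(3 + q, 2) => c c'; lia.
- by move: (binS4 (2 + q)%N); rewrite -[(2 + q.+4)%N]/((2 + q).+4);
    move: 'C((2 + q).+4, 2) 'C(2 + q, 2) => c c'; lia.
- by move: (binS4 (1 + q)%N); rewrite -[(1 + q.+4)%N]/((1 + q).+4);
    move: 'C((1 + q).+4, 2) 'C(1 + q, 2) => c c'; lia.
- by move: (binS4 (0 + q)%N); rewrite -[(0 + q.+4)%N]/((0 + q).+4);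
    move: 'C((0 + q).+4, 2) 'C(0 + q, 2) => c c'; lia.
Qed.

Section EighthRoot.
Variable R : rcfType.
Local Notation rRe := (@complex.Re R).
Local Notation rIm := (@complex.Im R).
Local Notation im := ('i%C : R[i]).
Local Notation r2 := (Num.sqrt 2%:R : R).

(** The eighth root of unity (1 + i) / sqrt 2. *)
Definition zeta8 : R[i] := (r2^-1)%:C%C * (1 + im).

Lemma sqrt2_sq : r2 * r2 = 2%:R.
Proof. by rewrite -expr2 sqr_sqrtr // ler0n. Qed.

Lemma sqrt2_neq0 : r2 != 0.
Proof. by rewrite sqrtr_eq0 -ltNge ltr0n. Qed.

Lemma zeta8_conj : zeta8^-1 = (r2^-1)%:C%C * (1 - im).
Proof.
have zz : zeta8 * ((r2^-1)%:C%C * (1 - im)) = 1.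
  rewrite /zeta8 mulrACA -rmorphM /= -invfM sqrt2_sq.
  rewrite [(1 + im) * _]mulrC -subr_sqr sqr_i opprK expr1n.
  by rewrite -[1 + 1](rmorph_nat (real_complex R) 2) -rmorphM /= mulVf ?pnatr_eq0.
have z0 : zeta8 != 0.
  by apply: contra_eq_neq zz => ->; rewrite mul0r eq_sym oner_eq0.
by apply: (mulfI z0); rewrite zz mulfV.
Qed.

Lemma zeta8_unit : zeta8 \is a GRing.unit.
Proof.
rewrite unitfE /zeta8 mulf_neq0 //.
  by rewrite fmorph_eq0 invr_eq0 sqrt2_neq0.
by rewrite eq_complex /= !addr0 !add0r oner_eq0.
Qed.

Lemma zeta8_4 : zeta8 ^ (4%:Z) = -1.
Proof.
have z2 : zeta8 ^+ 2 = im.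
  rewrite /zeta8 exprMn -rmorphXn /= exprVn expr2 sqrt2_sq sqrrD sqr_i expr1n mul1r.
  rewrite addrAC subrr add0r -(mulr_natl im) mulrA.
  by rewrite -(rmorph_nat (real_complex R) 2) -rmorphM /= mulVf ?pnatr_eq0 // mul1r.
by rewrite -exprnP (exprM _ 2 2) z2 sqr_i.
Qed.

Lemma zeta8_period (z k : int) : zeta8 ^ (z + k * 8) = zeta8 ^ z.
Proof.
rewrite expfzDr ?(unitfE, zeta8_unit) -?unitfE ?zeta8_unit //.
rewrite (_ : k * 8 = 4 * (2 * k)); last by ring.
rewrite -exprz_exp zeta8_4.
by rewrite -exprz_exp -exprnP sqrrN expr1n exp1rz mulr1.
Qed.

Lemma conj_zeta8 (z : int) : conjc (zeta8 ^ z) = zeta8 ^ (- z).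
Proof.
rewrite -exprz_inv.
have -> : zeta8^-1 = conjc zeta8.
  by rewrite zeta8_conj /zeta8; simpc.
exact: (fmorphXz (@conjc R)).
Qed.

(** The sine of z pi / 4. *)
Definition sin8 (z : int) : R := rIm (zeta8 ^ z).
(** The cosine of z pi / 4. *)
Definition cos8 (z : int) : R := rRe (zeta8 ^ z).

Lemma sin8_period z k : sin8 (z + k * 8) = sin8 z.
Proof. by rewrite /sin8 zeta8_period. Qed.

Lemma cos8_period z k : cos8 (z + k * 8) = cos8 z.
Proof. by rewrite /cos8 zeta8_period. Qed.

Lemma cos8N z : cos8 (- z) = cos8 z.
Proof. by rewrite /cos8 -conj_zeta8; case: (_ ^ _). Qed.

(** Here zeta8 ^ 4 = - 1 turns z |-> 4 - z into minus the complex conjugation. *)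
Lemma sin8_supp z : sin8 (4 - z) = sin8 z.
Proof.
rewrite /sin8 expfzDr -?unitfE ?zeta8_unit // zeta8_4 -conj_zeta8 mulN1r.
by case: (_ ^ _) => a b /=; rewrite opprK.
Qed.

Lemma odd_sign_sum_sin8 N :
  \sum_(A : {set 'I_N} | odd #|A|) (-1) ^+ 'C(#|A|, 2) = r2 ^+ N * sin8 N%:Z.
Proof.
rewrite odd_sign_sum /sin8 -exprnP /zeta8 exprMn -rmorphXn /=.
have ImZ k (z : R[i]) : rIm (k%:C%C * z) = k * rIm z by case: z => a b; simpc.
by rewrite ImZ mulrA -exprMn mulfV ?sqrt2_neq0 // expr1n mul1r.
Qed.

Lemma clsign_diag_sum_cos8 p q :
  \sum_(A : {set 'I_(p + q)}) clsign R A A =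
  r2 ^+ (p + q).+1 * cos8 (p%:Z - q%:Z + 1).
Proof.
have ReZ k (z : R[i]) : rRe (k%:C%C * z) = k * rRe z by case: z => a b; simpc.
have plusE : 1 + im = r2%:C%C * zeta8.
  by rewrite /zeta8 mulrA -rmorphM /= mulfV ?sqrt2_neq0 // mul1r.
have minusE : 1 - im = r2%:C%C * zeta8^-1.
  by rewrite zeta8_conj mulrA -rmorphM /= mulfV ?sqrt2_neq0 // mul1r.
rewrite clsign_diag_sum -exprS plusE minusE [(_ * zeta8^-1) ^+ _]exprMn.
rewrite [(_ * zeta8) ^+ _]exprMn -!rmorphXn /=.
rewrite mulrACA -rmorphM /= -exprD addSn ReZ -cos8N; congr (_ * rRe _).
rewrite exprVn !exprnP invr_expz -expfzDr -?unitfE ?zeta8_unit //.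
congr (_ ^ _); lia.
Qed.

End EighthRoot.

Section DimensionFormula.
Variable R : rcfType.
Local Notation r2 := (Num.sqrt 2%:R : R).

Lemma clsign_full p q :
  clsign R [set: 'I_(p + q)] [set: 'I_(p + q)] = (-1) ^+ (p + 'C(p + q, 2)).
Proof.
rewrite clsign_diag cardsT card_ord exprD; congr (_ * _).
rewrite /sqsign (eq_bigl xpredT) => [|i]; last by rewrite inE.
rewrite big_split_ord /= [X in X * _](eq_bigr (fun=> -1)) => [|i _].
  rewrite [X in _ * X]big1 => [|i _]; first by rewrite mulr1 prodr_const card_ord.
  by rewrite /psgn /= ltnNge leq_addr opprK.
by rewrite /psgn /= ltn_ord.
Qed.

Lemma splittingE p q :
  splitting R p q = if ((p + 3 * q) %% 4 == 3)%N then 2%N else 1%N.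
Proof.
rewrite /splitting clsign_full -splitting_parity; congr (if _ && _ then _ else _).
rewrite -signr_odd; case: (odd _) => /=; last by rewrite expr0 eqxx.
by rewrite expr1 eq_sym -addr_eq0 -mulr2n pnatr_eq0.
Qed.

Lemma quadratic_root_unique (a c x y : R) : 0 < a -> 0 < x -> 0 < y ->
  a * x ^+ 2 + c * x = 2%:R -> a * y ^+ 2 + c * y = 2%:R -> x = y.
Proof.
move=> a0 x0 y0 xE yE; apply/eqP; rewrite -subr_eq0.
have /eqP : (x - y) * (a * (x + y) + c) = 0.
  rewrite -(subrr 2%:R) -{1}xE -yE; ring.
rewrite mulf_eq0 => /orP[//|/eqP cE].
have cE' : c = - (a * (x + y)) by rewrite -[LHS](addKr (a * (x + y))) cE addr0.
have axy : 0 < a * (x * y) by rewrite !mulr_gt0.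
by move: xE axy; rewrite cE' => xE; nra.
Qed.

(** With mu the quotient of the dimension of the spinor module by sqrt 2 ^ n,
    the dimension of the space of equivariant maps is expressed by mu and n, and
    mu is the positive root of a quadratic equation depending on p - q only. *)
Lemma equivariant_dimP p q (sq : forall m, {vspace 'M[R]_m}) (eps : R) :
  (0 < p + q)%N -> eps * eps = 1 ->
  (forall m (M : 'M[R]_m), (M \in sq m) = (M^T == eps *: M)) ->
  exists mu : R, [/\ 0 < mu,
    (splitting R p q)%:R * mu ^+ 2 + (r2 * cos8 R (p%:Z - q%:Z + 1)) * mu = 2%:R &
    (equivariant_dim p q sq)%:R = mu ^+ 2 + eps * mu * sin8 R (p + q)%N%:Z].
Proof.
move=> n0 eps2 memW; pose n := (p + q)%N.
have [d0 Pd0] : exists d, [set d | exists m (rho : clmodule R p q m)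
      (U : {vspace 'Hom(subvs_of (sq m), 'cV[R]_n)}),
    [/\ irreducible rho,
        forall j, j \in U <-> equivariant rho j &
        d = \dim U]]%classic d.
  have [m [rho irr]] := irreducible_exists R p q.
  have [U UE dU] := equivariant_space rho eps2 (memW m) n0.
  by exists (\dim U), m, rho, U.
have [m [rho [U [irr UE dU]]]] := xgetPex 0%N (ex_intro _ d0 Pd0).
rewrite -/(equivariant_dim p q sq) in dU; rewrite dU.
have [V VE dV] := equivariant_space rho eps2 (memW m) n0.
have -> : U = V.
  by apply/vspaceP => j; apply/idP/idP => [/UE/VE|/VE/UE].
have m0 : 0 < m%:R :> R by case: irr => m0 _; rewrite ltr0n.
have s0 : r2 ^+ n != 0 by rewrite expf_neq0 // sqrt2_neq0.
have sE : 2%:R ^+ n = r2 ^+ n * r2 ^+ n :> R by rewrite -exprMn sqrt2_sq.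
exists (m%:R / r2 ^+ n); split.
- by rewrite divr_gt0 // exprn_gt0 // sqrtr_gt0 ltr0n.
- have := spinor_dim irr; rewrite clsign_diag_sum_cos8 -/n (exprS 2%:R) (exprS r2) sE.
  set s := r2 ^+ n in s0 *; set t := r2; set c := cos8 _ _ => H.
  apply: (mulIf (mulf_neq0 s0 s0)); rewrite -H.
  by field.
have := dim_twisted rho eps2; rewrite odd_sign_sum_sin8 dV -/n sE.
set s := r2 ^+ n in s0 * => H; apply: (mulIf (mulf_neq0 s0 s0)); rewrite H.
by field.
Qed.

End DimensionFormula.

(** * The group Gamma and the invariance *)

Local Open Scope classical_set_scope.

(** Congruence modulo 8, up to the reflections n |-> 4 - n and s |-> -2 - s;
    modulo 8 these are all the generating reflections of Gamma. *)
Definition mirrored (x y : Z2) : Prop :=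
  ((y.1 = x.1 %[mod 8])%Z \/ (y.1 = 4 - x.1 %[mod 8])%Z) /\
  ((y.2 = x.2 %[mod 8])%Z \/ (y.2 = - 2 - x.2 %[mod 8])%Z).

Lemma mirrored_trans y x z : mirrored x y -> mirrored y z -> mirrored x z.
Proof. by rewrite /mirrored; lia. Qed.

Lemma mirrored_sym x y : mirrored x y -> mirrored y x.
Proof. by rewrite /mirrored; lia. Qed.

Lemma mirrored_G x y : mirrored x y -> G x -> G y.
Proof. by rewrite /mirrored /G /=; lia. Qed.

Lemma mirrored_F x y : mirrored x y -> F x -> F y -> x = y.
Proof.
case: x y => [n s] [n' s']; rewrite /mirrored /= => xy [/= _ hn hs] [/= _ hn' hs'].
by congr (_, _); lia.
Qed.

Lemma Gamma_mirrored g x : Gamma g -> mirrored x (g x).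
Proof.
move=> Gg; elim: Gg x => {g} [g|||] => [[[[->|->]|->]|->] x|x|g h _ IHg _ IHh x|].
- by rewrite /mirrored /=; lia.
- by rewrite /mirrored /=; lia.
- by rewrite /mirrored /=; lia.
- by rewrite /mirrored /=; lia.
- by rewrite /mirrored /=; lia.
- exact: mirrored_trans (IHh x) (IHg (h x)).
- by move=> g h _ IH gK hK x; apply: mirrored_sym; rewrite -{2}(hK x); apply: IH.
Qed.

Lemma Gamma_exp g (k : nat) : Gamma g -> Gamma (iter k g).
Proof. by move=> Gg; elim: k => [|k IH]; [apply: gen_id | apply: gen_comp]. Qed.

(** The product of the two reflections in each coordinate is the translation
    by 8. *)
Lemma Gamma_translation (k l : int) :
  exists2 g, Gamma g & forall x, g x = (x.1 + k * 8, x.2 + l * 8).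
Proof.
have translation (r t : Z2 -> Z2) (v : Z2) (j : int) :
    reflections r -> reflections t -> cancel r r -> cancel t t ->
    (forall x, r (t x) = (x.1 + v.1, x.2 + v.2)) ->
    exists2 g, Gamma g & forall x, g x = (x.1 + j * v.1, x.2 + j * v.2).
  move=> Xr Xt rK tK rt.
  have iterE i x : iter i (r \o t) x = (x.1 + i%:Z * v.1, x.2 + i%:Z * v.2).
    elim: i => [|i IH]; first by rewrite /= !mul0r !addr0; case: x.
    by rewrite iterS IH /= rt /=; congr (_, _); rewrite intS; ring.
  have tr x : t (r x) = (x.1 - v.1, x.2 - v.2).
    by apply: (can_inj (can_comp rK tK)); rewrite /= tK rK rt /= !subrK; case: x.
  have iterN i x : iter i (t \o r) x = (x.1 - i%:Z * v.1, x.2 - i%:Z * v.2).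
    elim: i => [|i IH]; first by rewrite /= !mul0r !subr0; case: x.
    by rewrite iterS IH /= tr /=; congr (_, _); rewrite intS; ring.
  have [Gr Gt] := (gen_in Xr, gen_in Xt).
  case: j => i.
    by exists (iter i (r \o t)); [apply/Gamma_exp/gen_comp | exact: iterE].
  exists (iter i.+1 (t \o r)); first exact/Gamma_exp/gen_comp.
  by move=> x; rewrite iterN NegzE !mulNr.
have [g Gg gE] : exists2 g, Gamma g & forall x, g x = (x.1 + k * 8, x.2 + k * 0).
  apply: (translation (fun x => (4 - x.1, x.2)) (fun x => (- 4 - x.1, x.2)) (8, 0)).
  - by left; left; right.
  - by left; left; left.
  - by case=> a b /=; congr (_, _); ring.
  - by case=> a b /=; congr (_, _); ring.
  - by case=> a b /=; congr (_, _); ring.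
have [h Gh hE] : exists2 g, Gamma g & forall x, g x = (x.1 + l * 0, x.2 + l * 8).
  apply: (translation (fun x => (x.1, 6 - x.2)) (fun x => (x.1, - 2 - x.2)) (0, 8)).
  - by right.
  - by left; right.
  - by case=> a b /=; congr (_, _); ring.
  - by case=> a b /=; congr (_, _); ring.
  - by case=> a b /=; congr (_, _); ring.
exists (g \o h); first exact: gen_comp.
by move=> x /=; rewrite gE hE /= !mulr0 !addr0.
Qed.

(** A translation brings n into [-2, 5] and s into [-1, 6]; one further
    reflection in each coordinate suffices. *)
Lemma Gamma_meets_F x : G x -> exists2 g, Gamma g & F (g x).
Proof.
move=> Gx.
have [t Gt tE] := Gamma_translation (- ((x.1 + 2) %/ 8)%Z) (- ((x.2 + 1) %/ 8)%Z).
have [f Gf [f1 f2]] : exists2 f, Gamma f &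
    (-2 <= (f (t x)).1 <= 2 /\ (f (t x)).2 = (t x).2).
  have [n2|n2] := leP (t x).1 2.
    by exists id; [apply: gen_id | move: n2; rewrite tE /=; lia].
  exists (fun y => (4 - y.1, y.2)); first by apply: gen_in; left; left; right.
  by move: n2; rewrite tE /=; lia.
have [h Gh [h1 h2]] : exists2 h, Gamma h &
    (h (f (t x))).1 = (f (t x)).1 /\ -2 <= (h (f (t x))).2 - 1 <= 2.
  have [s2|s2] := leP (f (t x)).2 3.
    by exists id; [apply: gen_id | move: s2; rewrite f2 tE /=; lia].
  exists (fun y => (y.1, 6 - y.2)); first by apply: gen_in; right.
  by move: s2; rewrite f2 tE /=; lia.
have Gg : Gamma (h \o f \o t) by apply: gen_comp => //; apply: gen_comp.
exists (h \o f \o t) => //; split=> /=; last by [].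
  exact: mirrored_G (Gamma_mirrored x Gg) Gx.
by rewrite h1.
Qed.

Lemma fundamental_domain_F : fundamental_domain Gamma G F.
Proof.
split=> [g x Gg|x []//|x Gx]; first exact/mirrored_G/Gamma_mirrored.
have [g Gg Fg] := Gamma_meets_F Gx; exists (g x); split=> [|y [Fy [h Gh hxy]]].
  by split=> //; exists g.
apply: mirrored_F => //; apply: mirrored_trans (mirrored_sym (Gamma_mirrored x Gg)) _.
by rewrite -hxy; apply: Gamma_mirrored.
Qed.

(** The points of the fundamental domain. *)
Definition F_points : seq Z2 :=
  [:: (-2, 0); (-2, 2); (-1, -1); (-1, 1); (-1, 3); (0, 0);
      (0, 2); (1, -1); (1, 1); (1, 3); (2, 0); (2, 2)].

Lemma F_pointsP x : F x <-> x \in F_points.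
Proof.
pose inF (y : Z2) := [&& (2 %| y.1 + y.2)%Z, -2 <= y.1 <= 2 & -2 <= y.2 - 1 <= 2].
split=> [|/(allP (isT : all inF F_points))/and3P[]//].
have points : all (fun n => all (fun s => inF (n, s) ==> ((n, s) \in F_points))
   [:: -1; 0; 1; 2; 3]) [:: -2; -1; 0; 1; 2] by [].
case: x => n s [/= Gx hn hs]; have Fx : inF (n, s) by apply/and3P.
have ns : n \in [:: -2; -1; 0; 1; 2] by rewrite !inE; lia.
have ss : s \in [:: -1; 0; 1; 2; 3] by rewrite !inE; lia.
by have /allP/(_ n ns)/allP/(_ s ss)/implyP/(_ Fx) := points.
Qed.

Lemma card_F : (F #= `I_12)%card.
Proof.
apply/card_set_bijP; exists (index^~ F_points); split.
- move=> x /F_pointsP xF.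
  by have : (index x F_points < size F_points)%N by rewrite index_mem.
- move=> x y /set_mem/F_pointsP xF /set_mem/F_pointsP yF eq_i.
  by rewrite -(nth_index (0, 0) xF) eq_i nth_index.
- move=> i i12; exists (nth (0, 0) F_points i).
    by apply/F_pointsP; rewrite mem_nth.
  exact: index_uniq.
Qed.

Lemma equivariant_dim_mirrored (R : rcfType) p q p' q'
    (sq : forall m, {vspace 'M[R]_m}) (eps : R) :
  (0 < p + q)%N -> (0 < p' + q')%N -> eps * eps = 1 ->
  (forall m (M : 'M[R]_m), (M \in sq m) = (M^T == eps *: M)) ->
  mirrored ((p + q)%N%:Z, p%:Z - q%:Z) ((p' + q')%N%:Z, p'%:Z - q'%:Z) ->
  equivariant_dim p q sq = equivariant_dim p' q' sq.
Proof.
move=> n0 n0' eps2 memW [/= hn hs].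
have shift (a b : int) : (a = b %[mod 8])%Z -> exists k, a = b + k * 8.
  by move=> ab; exists ((a %/ 8)%Z - (b %/ 8)%Z); lia.
have sinE : sin8 R (p' + q')%N%:Z = sin8 R (p + q)%N%:Z.
  by case: hn => /shift[k ->]; rewrite sin8_period ?sin8_supp.
have cosE : cos8 R (p'%:Z - q'%:Z + 1) = cos8 R (p%:Z - q%:Z + 1).
  case: hs => /shift[k ->]; rewrite addrAC cos8_period // -[RHS]cos8N.
  by congr (cos8 _ _); ring.
have splitE : splitting R p' q' = splitting R p q.
  by rewrite !splittingE; congr (if _ then _ else _); move: hs; lia.
have [mu [mu0 muE dE]] := equivariant_dimP n0 eps2 memW.
have [nu [nu0 nuE dE']] := equivariant_dimP n0' eps2 memW.
rewrite splitE cosE in nuE; have split0 : 0 < (splitting R p q)%:R :> R.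
  by rewrite ltr0n splittingE; case: ifP.
have mu_nu := quadratic_root_unique split0 mu0 nu0 muE nuE.
by apply/eqP; rewrite -(eqr_nat R) dE dE' mu_nu sinE.
Qed.

(** A function of (p, q) that is constant on mirrored signatures has a periodic
    extension that is constant on mirrored points; each point of G is congruent
    to some signature. *)
Lemma periodic_ext_mirrored (l : nat -> nat -> nat) :
  (forall p q p' q', (0 < p + q)%N -> (0 < p' + q')%N ->
    mirrored ((p + q)%N%:Z, p%:Z - q%:Z) ((p' + q')%N%:Z, p'%:Z - q'%:Z) ->
    l p q = l p' q') ->
  forall x y, G x -> mirrored x y -> periodic_ext l x = periodic_ext l y.
Proof.
move=> l_mirrored.
have values z : G z -> exists p q, [/\ (0 < p + q)%N,
    mirrored z ((p + q)%N%:Z, p%:Z - q%:Z) & periodic_ext l z = l p q].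
  move=> Gz; rewrite /periodic_ext; case: xgetP => [_ -> [p [q [n0 hn hs ->]]]|none].
    by exists p, q; split=> //; split; left.
  pose a := `|(z.1 %% 8)%Z|%N; pose b := `|(z.2 %% 8)%Z|%N.
  exfalso; apply: (none (l ((a + 8 + b)./2) ((a + 8 - b)./2))).
  exists ((a + 8 + b)./2), ((a + 8 - b)./2).
  move: Gz; rewrite /G /a /b /= => Gz.
  by split=> //; lia.
move=> x y Gx xy; have Gy := mirrored_G xy Gx.
have [p [q [n0 xpq ->]]] := values x Gx.
have [p' [q' [n0' ypq ->]]] := values y Gy.
apply: l_mirrored => //.
exact: mirrored_trans (mirrored_sym xpq) (mirrored_trans xy ypq).
Qed.

Theorem mainTheorem2 (R : realType) :
  [/\ forall (g : Z2 -> Z2) (x : Z2), Gamma g -> G x ->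
        (Lplus R (g x), Lminus R (g x)) = (Lplus R x, Lminus R x),
      fundamental_domain Gamma G F &
      (F #= `I_12)%card].
Proof.
split; [move=> g x Gg Gx | exact: fundamental_domain_F | exact: card_F].
have xgx := Gamma_mirrored x Gg.
congr (_, _); apply/esym/periodic_ext_mirrored => // p q p' q' n0 n0'.
  apply: (equivariant_dim_mirrored (eps := 1)) => //; first by rewrite mulr1.
  by move=> m M; rewrite mem_sym2 scale1r.
apply: (equivariant_dim_mirrored (eps := -1)) => //; first by rewrite mulrNN mulr1.
by move=> m M; rewrite mem_ext2 scaleN1r.
Qed.
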